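(* Let $\mathfrak{H}$ and $\mathfrak{K}_n$, $n\in\mathbb{N}$, be Hilbert spaces and let $T_n\in\mathbf{L}(\mathfrak{H},\mathfrak{K}_n)$ be a sequence of linear relations which satisfy $T_m\prec_c T_n$ for $m\le n$. Let $H_\infty\in\mathbf{L}(\mathfrak{H})$ be the nonnegative selfadjoint relation which is the limit (in the strong resolvent sense or, equivalently, in the strong graph sense) of the nondecreasing sequence of nonnegative selfadjoint relations $T_n^*T_n^{**}\in\mathbf{L}(\mathfrak{H})$. Then $H_\infty$ satisfies $$\operatorname{dom}(H_\infty)^{\frac12}=\Big\{\varphi\in\bigcap_{n\in\mathbb{N}}\operatorname{dom}T_n^{**}:\ \sup_{n\in\mathbb{N}}\|(T_{n,\rm reg})^{**}\varphi\|<\infty\Big\}$$ and, furthermore, $$\|(T_{n,\rm reg})^{**}\varphi\|\nearrow\|(H_{\infty,\rm op})^{\frac12}\varphi\|,\quad\varphi\in\operatorname{dom}(H_\infty)^{\frac12}.$$ Moreover, the limit $S_{\rm r}\in\mathbf{L}(\mathfrak{H},\mathfrak{K}_{\rm c})$ of the sequence $(T_{n,\rm reg})^{**}\in\mathbf{L}(\mathfrak{H},\mathfrak{K}_n)$ satisfies $$\|(T_{n,\rm reg})^{**}\varphi\|\nearrow\|S_{\rm r}\varphi\|,\quad\varphi\in\operatorname{dom}S_{\rm r}=\operatorname{dom}(H_\infty)^{\frac12}.$$ Consequently, there exists a partial isometry $U\in\mathbf{L}(\mathfrak{K}_{\rm c},\mathfrak{H})$ such that $$(H_{\infty,\rm op})^{\frac12}=US_{\rm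 r}\quad\text{and}\quad H_{\infty,\rm op}=(S_{\rm r})^*S_{\rm r}.$$
   Context: $\mathbf{L}(\mathfrak{H},\mathfrak{K})$ is the class of all linear relations (linear subspaces of $\mathfrak{H}\times\mathfrak{K}$) between Hilbert spaces; $\mathbf{L}(\mathfrak{H})=\mathbf{L}(\mathfrak{H},\mathfrak{H})$. For a relation $T$, $\operatorname{mul}T=\{f':\{0,f'\}\in T\}$; $T$ is an operator if $\operatorname{mul}T=\{0\}$ (domains need not be dense). The adjoint is $T^*=\{\{g,g'\}\in\mathfrak{K}\times\mathfrak{H}:(g',f)=(g,f')\text{ for all }\{f,f'\}\in T\}$ and $T^{**}$ is the closure of $T$. Products of relations are $ST=\{\{f,f'\}:\{f,h\}\in T,\{h,f'\}\in S\text{ for some }h\}$. Contractive domination: $A\prec_c B$ for $A\in\mathbf{L}(\mathfrak{H},\mathfrak{H}_A)$, $B\in\mathbf{L}(\mathfrak{H},\mathfrak{H}_B)$ means that there is a contraction $C\in\mathbf{B}(\mathfrak{H}_B,\mathfrak{H}_A)$ (bounded, everywhere defined) with $CB=\{\{f,Cf'\}:\{f,f'\}\in B\}\subset A$. Regular part: $T_{\rm reg}=(I-P)T=\{\{f,(I-P)f'\}:\{f,f'\}\in T\}$, with $P$ the orthogonal projection of $\mathfrak{K}$ onto $\operatorname{mul}T^{**}$. It is a closable operator, $T_{n,\rm reg}=(T_n)_{\rm reg}$, and $(T_{\rm reg})^{**}=(T^{**})_{\rm reg}$. Nonnegative selfadjoint relations: $H\in\mathbf{L}(\mathfrak{H})$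 is selfadjoint if $H=H^*$ and nonnegative if $(f',f)\ge0$ for all $\{f,f'\}\in H$. Its orthogonal operator part $H_{\rm op}=H_{\rm reg}$ is a nonnegative selfadjoint operator in the Hilbert space $\overline{\operatorname{dom}}\,H=(\operatorname{mul}H)^\perp$, and $H^{\frac12}$ is the nonnegative selfadjoint relation with $H^{\frac12}H^{\frac12}=H$; one has $\operatorname{mul}H^{\frac12}=\operatorname{mul}H$ and $(H^{\frac12})_{\rm reg}=(H_{\rm reg})^{\frac12}$. The order $H_1\le H_2$ means $\operatorname{dom}H_2^{\frac12}\subset\operatorname{dom}H_1^{\frac12}$ and $\|(H_{1,\rm reg})^{\frac12}f\|\le\|(H_{2,\rm reg})^{\frac12}f\|$ for $f\in\operatorname{dom}H_2^{\frac12}$. For any linear relation $T_n$ the product $T_n^*T_n^{**}$ is nonnegative and selfadjoint; under the assumption $T_m\prec_cT_n$, $m\le n$, these products are nondecreasing with respect to the order $\le$ for nonnegative selfadjoint relations, i.e. $T_m^*T_m^{**}\le T_n^*T_n^{**}$ for $m\le n$, and by the known monotonicity principle they converge to a nonnegative selfadjoint relation. Strong resolvent convergence $H_n\to H_\infty$ means that $(H_n-\lambda)^{-1}$ converges strongly to $(H_\infty-\lambda)^{-1}$ for $\lambda\in\mathbb{C}\setminus[0,\infty)$. Strong graph convergence means that $H_\infty$ consists of all $\{h,h'\}$ for which there are $\{h_n,h_n'\}\in H_n$ with $\{h_n,h_n'\}\to\{h,h'\}$. The limit $S_{\rm r}$: the closed operators $(T_{n,\rm reg})^{**}$ are nondecreasing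 with respect to $\prec_c$, and $S_{\rm r}\in\mathbf{L}(\mathfrak{H},\mathfrak{K}_{\rm c})$, with $\mathfrak{K}_{\rm c}$ a Hilbert space, is a closed linear operator with $\operatorname{dom}S_{\rm r}=\{\varphi\in\bigcap_n\operatorname{dom}T_n^{**}:\sup_n\|(T_{n,\rm reg})^{**}\varphi\|<\infty\}$ and $\|(T_{n,\rm reg})^{**}\varphi\|\nearrow\|S_{\rm r}\varphi\|$ for $\varphi\in\operatorname{dom}S_{\rm r}$; it exists and is unique up to partial isometries (and then automatically $(T_{n,\rm reg})^{**}\prec_c S_{\rm r}$). A partial isometry is a bounded everywhere defined operator; $\nearrow$ denotes nondecreasing convergence.
   Formalization: In the last equality the adjoint of S_r is taken from the closure of dom S_r to K_c, since with the adjoint in K_c × H it fails for non-dense dom S_r (T_n = n on C); H_∞ = (S_r)^*S_r with the full adjoint is also proved. *)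

(* Defs.v *)
From HB Require Import structures.
From mathcomp Require Import all_boot all_order all_algebra.
From mathcomp Require Import complex.
From mathcomp Require Import all_classical all_reals.
From mathcomp Require Import ereal topology normedtype sequences.

Set Implicit Arguments.
Unset Strict Implicit.
Unset Printing Implicit Defensive.

Import Order.TTheory GRing.Theory Num.Theory.
Import numFieldNormedType.Exports.

Local Open Scope classical_set_scope.
Local Open Scope ring_scope.

(* Complex Hilbert spaces; [inner] is linear in its first argument and
   conjugate-linear in the second one. *)
HB.mixin Record isHilbert (R : realType) H of CompleteNormedModule R[i] H := {
  inner : {dot H for (@Num.conj R[i])} ;
  inner_norm : forall x : H, inner x x = `|x| ^+ 2
}.

#[short(type="hilbertType")]
HB.structure Definition Hilbert (R : realType) :=
  {H of isHilbert R H & CompleteNormedModule R[i] H}.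

(* The norm of a normed module over R[i] takes its values in R[i]; [hnorm] is
   the same number as an element of R. *)
Definition hnorm (R : realType) (H : hilbertType R) (x : H) : R :=
  complex.Re `|x|.

Section LinearRelations.
Context {R : realType}.
Implicit Types H K L : hilbertType R.

Definition linear_relation H K (T : set (H * K)) : Prop :=
  submod_closed [in T].

Definition rel_dom H K (T : set (H * K)) : set H :=
  [set f | exists f', T (f, f')].

Definition rel_mul H K (T : set (H * K)) : set K := [set f' | T (0, f')].

Definition is_operator H K (T : set (H * K)) : Prop := rel_mul T = [set 0].

Definition rel_graph H K (C : H -> K) : set (H * K) :=
  [set f | f.2 = C f.1].

(* The value at x when T is an operator and x is in its domain; the junk value
   0 when x is outside the domain. *)
Definition rel_app H K (T : set (H * K)) (x : H) : K :=
  xget 0 [set y | T (x, y)].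

Definition rel_adj H K (T : set (H * K)) : set (K * H) :=
  [set g | forall f, T f -> inner g.2 f.1 = inner g.1 f.2].

Definition rel_biadj H K (T : set (H * K)) : set (H * K) :=
  rel_adj (rel_adj T).

(* The adjoint of T seen as a relation from the Hilbert space X to the Hilbert
   space Y, for closed subspaces X of H and Y of K with T included in X x Y. *)
Definition rel_adj_in H K (X : set H) (Y : set K) (T : set (H * K)) :
    set (K * H) :=
  rel_adj T `&` (Y `*` X).

(* A \prec_c B *)
Definition contr_dominated H K L (A : set (H * K)) (B : set (H * L)) : Prop :=
  exists2 C : {linear L -> K}, (forall x, hnorm (C x) <= hnorm x) &
    (rel_graph C \; B)%relation `<=` A.

Definition orth_proj H (M : set H) (x : H) : H :=
  xget 0 [set p | M p /\ forall m, M m -> inner (x - p) m = 0].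

Definition rel_reg H K (T : set (H * K)) : set (H * K) :=
  (rel_graph (fun f' => f' - orth_proj (rel_mul (rel_biadj T)) f')
     \; T)%relation.

Definition rel_nonneg H (T : set (H * H)) : Prop :=
  forall f f', T (f, f') -> 0 <= inner f' f.

Definition nonneg_selfadjoint H (T : set (H * H)) : Prop :=
  T = rel_adj T /\ rel_nonneg T.

(* Nonnegative selfadjoint relations in the Hilbert space X, for a closed
   subspace X of H. *)
Definition nonneg_selfadjoint_in H (X : set H) (T : set (H * H)) : Prop :=
  T = rel_adj_in X X T /\ rel_nonneg T.

Definition rel_sqrt H (T : set (H * H)) : set (H * H) :=
  xget set0 [set S | nonneg_selfadjoint S /\ (S \; S)%relation = T].

Definition rel_sqrt_in H (X : set H) (T : set (H * H)) : set (H * H) :=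
  xget set0 [set S | nonneg_selfadjoint_in X S /\ (S \; S)%relation = T].

(* The operator part of a nonnegative selfadjoint relation T is T_reg; it is
   selfadjoint in the closure of dom T, and in general not in H, so its square
   root is the one in that subspace. *)
Definition op_part H (T : set (H * H)) : set (H * H) := rel_reg T.

Definition sqrt_op_part H (T : set (H * H)) : set (H * H) :=
  rel_sqrt_in (closure (rel_dom T)) (op_part T).

(* (T - l)^{-1} *)
Definition rel_resolvent H (T : set (H * H)) (l : R[i]) : set (H * H) :=
  [set g | exists2 f, T f & g = (f.2 - l *: f.1, f.1)].

(* [0 <= l] in R[i] means that l is a nonnegative real number. *)
Definition strong_resolvent_cvg H (T : nat -> set (H * H))
    (Tinf : set (H * H)) : Prop :=
  forall l : R[i], ~ (0 <= l) -> forall h : H,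
    (fun n => rel_app (rel_resolvent (T n) l) h) @ \oo -->
      rel_app (rel_resolvent Tinf l) h.

Definition strong_graph_cvg H (T : nat -> set (H * H))
    (Tinf : set (H * H)) : Prop :=
  Tinf = [set h | exists2 u : nat -> H * H,
                    (forall n, T n (u n)) & u @ \oo --> h].

Definition nondecreasing_cvg (u : nat -> R) (l : R) : Prop :=
  nondecreasing_seq u /\ u @ \oo --> l.

Definition reg_norm H K (T : set (H * K)) (x : H) : R :=
  hnorm (rel_app (rel_biadj (rel_reg T)) x).

Definition limit_dom H (K : nat -> hilbertType R)
    (T : forall n, set (H * K n)) : set H :=
  (\bigcap_n rel_dom (rel_biadj (T n))) `&`
  [set x | (ereal_sup (range (fun n => (reg_norm (T n) x)%:E)) < +oo)%E].

(* S is the limit S_r of the operators (T_{n,reg})^{**}. *)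
Definition is_limit_operator H (K : nat -> hilbertType R)
    (T : forall n, set (H * K n)) (L : hilbertType R) (S : set (H * L)) :
    Prop :=
  [/\ linear_relation S, closed S, is_operator S, rel_dom S = limit_dom T &
      forall x, rel_dom S x ->
        nondecreasing_cvg (fun n => reg_norm (T n) x) (hnorm (rel_app S x))].

(* A partial isometry is isometric on the orthogonal complement of its
   kernel. *)
Definition partial_isometry H K (U : {linear H -> K}) : Prop :=
  continuous U /\
  forall x, (forall k, U k = 0 -> inner x k = 0) -> hnorm (U x) = hnorm x.

End LinearRelations.

(* Main.v *)
Require Import Defs.
From HB Require Import structures.
From mathcomp Require Import all_boot all_order all_algebra.
From mathcomp Require Import complex.
From mathcomp Require Import all_classical all_reals.
From mathcomp Require Import ereal topology normedtype sequences.
From mathcomp Require Import ring lra.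

(** Why the theorem holds.

    For a closed relation A the product A* A is nonnegative and selfadjoint,
    and for {f, f'} in A* A the regular part satisfies
    (f', f) = ||A_reg f||^2.  So A* A determines the quadratic form
    ||A_reg f||^2 on dom A* A, and dom A* A is a core for A_reg: the whole
    form, including its domain dom A, can be read off from A* A.  This is
    used in a form that covers H_oo together with the whole sequence T_n.

    Let S be nonnegative selfadjoint.  A vector x is in the form domain of S
    when |(x, f')|^2 <= c (f', f) on S for some c.  For such an x the vectors
    u_k = (I + S/k)^{-1} x approximate x, and the values (v_k, u_k) with
    {u_k, v_k} in S are nondecreasing, bounded by c, and control
    (v_m - v_n, u_m - u_n): they form a Cauchy sequence for the form
    ([yosida]).  If every element of S is a limit of elements of A_n* A_n,
    where the A_n are closed and nondecreasing for contractive domination, then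
    - a vector x in every dom A_n with ||A_{n,reg} x|| bounded lies in the
      form domain of S, because (x, v) = (A_{n,reg} x, A_{n,reg} u) on
      A_n* A_n ([form_bound]);
    - a vector x with such approximations u_k lies in every dom A_n, and
      ||A_{n,reg} x||^2 tends to lim (v_k, u_k) ([form_seq_val]).
    Both kinds of convergence of T_n* T_n** to H_oo provide the approximation
    of elements ([limit_approx]), with A_n = T_n**.  When B* B = S, the
    constant sequence B satisfies the hypotheses too.  Comparing the two
    sequences gives dom B = {x : sup ||A_{n,reg} x|| < oo} and
    ||A_{n,reg} x|| -> ||B_reg x|| for every closed B with B* B = H_oo
    ([dom_limit], [norm_limit]).  Every square root of H_oo, and every square
    root of its operator part, is such a B ([rel_sqrtP], [sqrt_op_partP]).

    What remains is the existence of square roots, which reduces to bounded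
    operators: with P^2 = (I + S)^{-1} and Q^2 = I - P^2 the relation
    {{P y, Q y}} is a square root of S ([nsa_roots], [sqrt_in_ex]).
    Finally S_r and the square root of the operator part have the same domain
    and the same norms, so S_r* S_r = H_oo by polarization ([adjmul_iso]) and
    S_r x |-> (H_{oo,op})^{1/2} x extends to a partial isometry
    ([partial_isometry_ex]). *)

Set Implicit Arguments.
Unset Strict Implicit.
Unset Printing Implicit Defensive.

Import Order.TTheory GRing.Theory Num.Theory.
Import numFieldNormedType.Exports.

Local Open Scope classical_set_scope.
Local Open Scope ring_scope.

(** * The real inner product and sequential convergence *)

Section RealInnerProduct.
Context {R : realType}.
Implicit Types H K L : hilbertType R.

(** The real part of the inner product. Every subspace below is complex, so
    replacing a vector by its multiple by i recovers the imaginary part; real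
    inner products then suffice, and they can be handled by linear
    arithmetic. *)
Definition ip H (x y : H) : R := complex.Re (inner x y).

Lemma ReD (a b : R[i]) : complex.Re (a + b) = complex.Re a + complex.Re b.
Proof. by case: a; case: b. Qed.

Lemma ReN (a : R[i]) : complex.Re (- a) = - complex.Re a.
Proof. by case: a. Qed.

Lemma innerC H (x y : H) : inner x y = (inner y x)^*%C.
Proof. by rewrite (hermC inner) expr0 mul1r. Qed.

Lemma ipC H (x y : H) : ip x y = ip y x.
Proof. by rewrite /ip innerC; case: (inner y x). Qed.

Lemma ipDl H (x y z : H) : ip (x + y) z = ip x z + ip y z.
Proof. by rewrite /ip linearDl ReD. Qed.

Lemma ipNl H (x z : H) : ip (- x) z = - ip x z.
Proof. by rewrite /ip linearNl ReN. Qed.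

Lemma ip0l H (z : H) : ip 0 z = 0.
Proof. by rewrite /ip linear0l. Qed.

Lemma ipZl H (c : R) (x z : H) : ip (c%:C%C *: x) z = c * ip x z.
Proof.
rewrite /ip linearZl_LR /=; case: (inner x z) => a b /=.
by rewrite mul0r subr0.
Qed.

Lemma ipDr H (x y z : H) : ip z (x + y) = ip z x + ip z y.
Proof. by rewrite !(ipC z) ipDl. Qed.

Lemma ipNr H (x z : H) : ip z (- x) = - ip z x.
Proof. by rewrite !(ipC z) ipNl. Qed.

Lemma ip0r H (z : H) : ip z 0 = 0.
Proof. by rewrite ipC ip0l. Qed.

Lemma ipZr H (c : R) (x z : H) : ip z (c%:C%C *: x) = c * ip z x.
Proof. by rewrite !(ipC z) ipZl. Qed.

Definition ipE H := (@ipDl H, @ipDr H, @ipNl H, @ipNr H, @ipZl H, @ipZr H,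
  @ip0l H, @ip0r H).

Lemma hnormE H (x : H) : hnorm x ^+ 2 = ip x x.
Proof.
rewrite /ip inner_norm /hnorm.
have : 0 <= `|x| by apply: normr_ge0.
case: (`|x|) => a b; rewrite lecE /= => /andP[/eqP -> _].
by rewrite mulr0 subr0.
Qed.

Lemma hnorm_ge0 H (x : H) : 0 <= hnorm x.
Proof.
have : 0 <= `|x| by apply: normr_ge0.
by rewrite /hnorm lecE => /andP[].
Qed.

Lemma normC_hnorm H (x : H) : `|x| = (hnorm x)%:C%C.
Proof.
have : 0 <= `|x| by apply: normr_ge0.
by rewrite /hnorm; case: (`|x|) => a b; rewrite lecE /= => /andP[/eqP -> _].
Qed.

Lemma ip_ge0 H (x : H) : 0 <= ip x x.
Proof. by rewrite -hnormE sqr_ge0. Qed.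

Lemma hnorm_sqrt H (x : H) : hnorm x = Num.sqrt (ip x x).
Proof. by rewrite -hnormE sqrtr_sqr ger0_norm // hnorm_ge0. Qed.

Lemma ip_eq0 H (x : H) : ip x x = 0 -> x = 0.
Proof.
rewrite -hnormE => /eqP; rewrite sqrf_eq0 => /eqP h.
by apply/normr0_eq0; rewrite normC_hnorm h.
Qed.

Lemma ip_ext H (x y : H) : (forall z, ip x z = ip y z) -> x = y.
Proof.
move=> h; apply/eqP; rewrite -subr_eq0; apply/eqP/ip_eq0.
by rewrite ipDl ipNl h subrr.
Qed.

Lemma ip_CS H (x y : H) : ip x y ^+ 2 <= ip x x * ip y y.
Proof.
have [/eqP y0|y0] := boolP (ip y y == 0).
  by rewrite (ip_eq0 y0) !ipE mulr0 expr0n.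
have yp : 0 < ip y y by rewrite lt_def y0 ip_ge0.
have := ip_ge0 ((ip y y)%:C%C *: x - (ip x y)%:C%C *: y).
rewrite !ipE (ipC y x) => h.
have : 0 <= ip y y * (ip x x * ip y y - ip x y ^+ 2) by nra.
by rewrite pmulr_rge0 // subr_ge0.
Qed.

Lemma inner_imag H (x y : H) : complex.Im (inner x y) = ip x ('i%C *: y).
Proof.
rewrite /ip linearZr_LR /=; case: (inner x y) => a b /=.
by rewrite !(mul0r,mulN1r) opprK add0r.
Qed.

Lemma inner_eq H K (x y : H) (z w : K) :
  ip x y = ip z w -> ip x ('i%C *: y) = ip z ('i%C *: w) ->
  inner x y = inner z w.
Proof.
rewrite -!inner_imag /ip => h1 h2.
by apply/eqP; rewrite eq_complex h1 h2 !eqxx.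
Qed.

(** Norm convergence, stated by a real sequence rather than by the
    R[i]-valued norm. *)
Definition hcvg H (u : nat -> H) (x : H) : Prop :=
  (fun n => ip (u n - x) (u n - x)) @ \oo --> (0 : R).

Lemma cvg0_le (a b : nat -> R) : (forall n, 0 <= a n <= b n) ->
  b @ \oo --> (0 : R) -> a @ \oo --> (0 : R).
Proof.
move=> h hb; by apply: (squeeze_cvgr _ (cvg_cst (0 : R)) hb); apply: nearW.
Qed.

Lemma cvg_sqr0 (a : nat -> R) :
  (fun n => a n ^+ 2) @ \oo --> (0 : R) -> a @ \oo --> (0 : R).
Proof.
move=> h; apply/cvgrPdist_lt => e e0.
have e2 : 0 < e ^+ 2 by rewrite exprn_gt0.
move/cvgrPdist_lt : h => /(_ _ e2); apply: filterS => n.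
rewrite !sub0r !normrN normrX => h.
by rewrite -(@ltr_pXn2r _ 2) ?nnegrE // ltW.
Qed.

Lemma ipD_le H (x y : H) : ip (x + y) (x + y) <= 2 * ip x x + 2 * ip y y.
Proof.
have := ip_ge0 (x - y); rewrite !ipE (ipC y x); lra.
Qed.

Lemma hcvgD H (u v : nat -> H) x y : hcvg u x -> hcvg v y ->
  hcvg (fun n => u n + v n) (x + y).
Proof.
move=> hu hv.
apply: (@cvg0_le _ (fun n => 2 * ip (u n - x) (u n - x) +
  2 * ip (v n - y) (v n - y))) => [n|].
  rewrite ip_ge0 /=.
  have -> : u n + v n - (x + y) = (u n - x) + (v n - y).
    by rewrite opprD addrACA.
  exact: ipD_le.
rewrite -[X in _ --> X](_ : 2 * 0 + 2 * 0 = 0 :> R);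
  last by rewrite mulr0 addr0.
by apply: cvgD; apply: cvgM => //; apply: cvg_cst.
Qed.

Lemma hcvg_cst H (x : H) : hcvg (fun=> x) x.
Proof. by rewrite /hcvg subrr ip0l; apply: cvg_cst. Qed.

Lemma hcvgN H (u : nat -> H) x : hcvg u x -> hcvg (fun n => - u n) (- x).
Proof.
by rewrite /hcvg; under [X in _ -> X @ _ --> _]eq_fun do
  rewrite -opprD ipNl ipNr opprK.
Qed.

Lemma hcvgB H (u v : nat -> H) x y : hcvg u x -> hcvg v y ->
  hcvg (fun n => u n - v n) (x - y).
Proof. by move=> hu hv; apply: hcvgD => //; apply: hcvgN. Qed.

Lemma hcvg_ipl H (u : nat -> H) x z :
  hcvg u x -> (fun n => ip (u n) z) @ \oo --> ip x z.
Proof.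
move=> hu; apply/subr_cvg0; apply: cvg_sqr0.
apply: (@cvg0_le _ (fun n => ip (u n - x) (u n - x) * ip z z)) => [n|].
  by rewrite sqr_ge0 /= -ipNl -ipDl ip_CS.
rewrite -[X in _ --> X](_ : 0 * ip z z = 0); last by rewrite mul0r.
by apply: cvgM => //; apply: cvg_cst.
Qed.

Lemma hcvg_ip H (u v : nat -> H) x y : hcvg u x -> hcvg v y ->
  (fun n => ip (u n) (v n)) @ \oo --> ip x y.
Proof.
move=> hu hv.
have -> : (fun n => ip (u n) (v n)) =
    (fun n => ip (u n - x) (v n - y) + ip (u n) y + (ip (v n) x - ip x y)).
  by apply/funext => n; rewrite !ipE (ipC (v n) x); ring.
rewrite -[X in _ --> X](_ : 0 + ip x y + (ip y x - ip x y) = ip x y);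
  last by rewrite (ipC y x) subrr addr0 add0r.
apply: cvgD; first apply: cvgD.
- apply: cvg_sqr0.
  apply: (@cvg0_le _
    (fun n => ip (u n - x) (u n - x) * ip (v n - y) (v n - y))).
    by move=> n; rewrite sqr_ge0 ip_CS.
  rewrite -[X in _ --> X](_ : 0 * 0 = 0 :> R); last by rewrite mul0r.
  exact: cvgM.
- exact: hcvg_ipl.
- by apply: cvgB; [exact: hcvg_ipl|exact: cvg_cst].
Qed.

Lemma scale_split H (a : R[i]) (x : H) :
  a *: x = (complex.Re a)%:C%C *: x + (complex.Im a)%:C%C *: ('i%C *: x).
Proof.
by rewrite scalerA -scalerDl {1}(complexE a) [(complex.Im a)%:C%C * _]mulrC.
Qed.

Lemma ip_i H (x y : H) : ip ('i%C *: x) y = - ip x ('i%C *: y).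
Proof.
rewrite /ip linearZl_LR linearZr_LR /=; case: (inner x y) => b c /=; ring.
Qed.

Lemma ipZZ H (a : R[i]) (x : H) : ip (a *: x) (a *: x) =
  (complex.Re a ^+ 2 + complex.Im a ^+ 2) * ip x x.
Proof.
have h : ip x ('i%C *: x) = 0.
  by have := ip_i x x; rewrite ipC; lra.
have hi : ip ('i%C *: x) ('i%C *: x) = ip x x.
  by rewrite ip_i scalerA -expr2 sqr_i scaleN1r ipNr opprK.
by rewrite scale_split !ipE hi (ipC _ x) h; ring.
Qed.

Lemma hcvgZ H (a : R[i]) (u : nat -> H) x : hcvg u x ->
  hcvg (fun n => a *: u n) (a *: x).
Proof.
rewrite /hcvg => hu.
have -> : (fun n => ip (a *: u n - a *: x) (a *: u n - a *: x)) =
    (fun n => (complex.Re a ^+ 2 + complex.Im a ^+ 2) * ip (u n - x) (u n - x)).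
  by apply/funext => n; rewrite -scalerBr ipZZ.
rewrite -[X in _ --> X](mulr0 (complex.Re a ^+ 2 + complex.Im a ^+ 2)).
by apply: cvgM => //; exact: cvg_cst.
Qed.

Lemma cvgn_unique (a : nat -> R) (x y : R) :
  a @ \oo --> x -> a @ \oo --> y -> x = y.
Proof. by move=> ha hb; rewrite -(cvg_lim _ ha)// -(cvg_lim _ hb). Qed.

Lemma hcvg_unique H (u : nat -> H) x y : hcvg u x -> hcvg u y -> x = y.
Proof.
move=> hx hy; apply: ip_ext => z.
by apply: (cvgn_unique (hcvg_ipl (z := z) hx)); apply: hcvg_ipl.
Qed.

Lemma hnorm_lt H (x : H) (e : R) : 0 < e -> (hnorm x < e) = (ip x x < e ^+ 2).
Proof.
by move=> e0; rewrite -hnormE ltr_pXn2r // nnegrE ?hnorm_ge0 // ltW.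
Qed.

Lemma hcvgP H (u : nat -> H) x : u @ \oo --> x <-> hcvg u x.
Proof.
split=> [hu|hu].
- apply/cvgrPdist_lt => e e0.
  have s0 : 0 < Num.sqrt e by rewrite sqrtr_gt0.
  move/cvgrPdist_lt : hu => /(_ (Num.sqrt e)%:C%C).
  rewrite ltcR => /(_ s0); apply: filterS => n.
  rewrite normC_hnorm ltcR hnorm_lt // sqr_sqrtr ?ltW //.
  rewrite sub0r normrN ger0_norm ?ip_ge0 // -[x - u n]opprB ipNl ipNr opprK.
  by [].
- apply/cvgrPdist_lt => e e0.
  have [r r0 ->] : exists2 r : R, 0 < r & e = r%:C%C.
    move: e0; case: e => a b; rewrite ltcE /= => /andP[/eqP -> a0].
    by exists a.
  have r2 : 0 < r ^+ 2 by rewrite exprn_gt0.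
  move/cvgrPdist_lt : hu => /(_ _ r2); apply: filterS => n.
  rewrite sub0r normrN ger0_norm ?ip_ge0 // normC_hnorm ltcR hnorm_lt //.
  by rewrite -[x - u n]opprB ipNl ipNr opprK.
Qed.

Lemma hcomplete H (u : nat -> H) :
  (forall e : R, 0 < e -> exists N, forall m n, (N <= m)%N -> (N <= n)%N ->
     ip (u m - u n) (u m - u n) < e) -> exists x, hcvg u x.
Proof.
move=> hc.
have : cauchy (u @ \oo).
  apply/cauchyP => e e0.
  have [r r0 ->] : exists2 r : R, 0 < r & e = r%:C%C.
    move: e0; case: e => a b; rewrite ltcE /= => /andP[/eqP -> a0].
    by exists a.
  have r2 : 0 < r ^+ 2 by rewrite exprn_gt0.
  have [N hN] := hc _ r2.
  exists (u N); exists N => //= n /= Nn.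
  rewrite -ball_normE /= normC_hnorm ltcR hnorm_lt //.
  exact: hN.
move/cauchy_cvgP => /(_ _) hu.
by exists (lim (u @ \oo)); apply/hcvgP; apply: hu.
Qed.

Lemma cvg0_N (a : nat -> R) : (forall n, 0 <= a n) ->
  a @ \oo --> (0 : R) ->
  forall e, 0 < e -> exists N, forall n, (N <= n)%N -> a n < e.
Proof.
move=> a0 /cvgrPdist_lt ha e e0.
have [N _ hN] := ha _ e0.
by exists N => n /hN; rewrite sub0r normrN ger0_norm.
Qed.

(** A bound by [a m + a n] is what minimizing sequences and sequences with
    monotone norms provide. *)
Lemma hcomplete2 H (u : nat -> H) (a : nat -> R) :
  (forall m n, (m <= n)%N -> ip (u m - u n) (u m - u n) <= a m + a n) ->
  a @ \oo --> (0 : R) -> exists x, hcvg u x.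
Proof.
move=> hu ha; apply: hcomplete => e e0.
have a0 n : 0 <= a n.
  by have := hu n n (leqnn n); have := ip_ge0 (u n - u n); lra.
have e2 : 0 < e / 2 by rewrite divr_gt0.
have [N hN] := cvg0_N a0 ha e2.
exists N => m n hm hn.
have := hN _ hm; have := hN _ hn.
have [/hu|/ltnW/hu] := leqP m n; first lra.
rewrite -[u m - u n]opprB ipNl ipNr opprK; lra.
Qed.

End RealInnerProduct.

(** * Closed linear relations, projections and adjoints *)

Section LinearRelationTheory.
Context {R : realType}.
Implicit Types H K L : hilbertType R.

Lemma linP H K (T : set (H * K)) : linear_relation T <->
  T (0, 0) /\ forall (a : R[i]) x x' y y', T (x, x') -> T (y, y') ->
    T (a *: x + y, a *: x' + y').
Proof.
split=> [[h0 h1]|[h0 h1]].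
  split=> [|a x x' y y' hx hy]; first by apply/set_mem; exact: h0.
  by apply/set_mem; apply: (h1 a (x, x') (y, y')); apply/mem_set.
split; first exact/mem_set.
move=> a [x x'] [y y'] /set_mem hx /set_mem hy.
by apply/mem_set; apply: h1.
Qed.

Section Ops.
Variables (H K : hilbertType R) (T : set (H * K)).
Hypothesis linT : linear_relation T.

Lemma lin0 : T (0, 0).
Proof. by have /linP[] := linT. Qed.

Lemma linZ a x x' : T (x, x') -> T (a *: x, a *: x').
Proof.
have /linP[h0 h1] := linT => hx.
by have := h1 a _ _ _ _ hx h0; rewrite !addr0.
Qed.

Lemma linD x x' y y' : T (x, x') -> T (y, y') -> T (x + y, x' + y').
Proof.
have /linP[h0 h1] := linT => hx hy.
by have := h1 1 _ _ _ _ hx hy; rewrite !scale1r.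
Qed.

Lemma linN x x' : T (x, x') -> T (- x, - x').
Proof. by move=> hx; have := linZ (-1) hx; rewrite !scaleN1r. Qed.

Lemma linB x x' y y' : T (x, x') -> T (y, y') -> T (x - y, x' - y').
Proof. by move=> hx hy; apply: linD => //; apply: linN. Qed.

(** Multiplying by i inside T recovers the imaginary part of the defining
    equation from its real part. *)
Lemma adjP g g' : rel_adj T (g, g') <->
  forall f f', T (f, f') -> ip g' f = ip g f'.
Proof.
split=> [h f f' hf|h [f f'] hf].
  by rewrite /ip (h _ hf).
by apply: inner_eq => /=; apply: h => //; apply: linZ.
Qed.

End Ops.

Definition sclosed H K (T : set (H * K)) : Prop :=
  forall u v x y, (forall n, T (u n, v n)) -> hcvg u x -> hcvg v y -> T (x, y).

Lemma adj_lin H K (T : set (H * K)) : linear_relation (rel_adj T).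
Proof.
apply/linP; split=> [f _|a x x' y y' hx hy f hf] /=; first by rewrite !linear0l.
by rewrite !linearPl /= (hx _ hf) (hy _ hf).
Qed.

Lemma adj_sclosed H K (T : set (H * K)) : linear_relation T ->
  sclosed (rel_adj T).
Proof.
move=> linT u v x y huv hu hv; apply/(adjP linT) => f f' hf.
apply: (cvgn_unique (hcvg_ipl (z := f) hv)).
have -> : (fun n => ip (v n) f) = (fun n => ip (u n) f').
  by apply/funext => n; exact/(adjP linT _ _).1.
exact: hcvg_ipl.
Qed.

Lemma biadj_lin H K (T : set (H * K)) : linear_relation (rel_biadj T).
Proof. exact: adj_lin. Qed.

Lemma biadj_sclosed H K (T : set (H * K)) : sclosed (rel_biadj T).
Proof. exact/adj_sclosed/adj_lin. Qed.

Lemma cvg_harmonic2 (c : R) : (fun n => c / n.+1%:R) @ \oo --> (0 : R).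
Proof.
rewrite -[X in _ --> X](_ : c * 0 = 0); last by rewrite mulr0.
by apply: cvgM; [exact: cvg_cst|exact: cvg_harmonic].
Qed.

(** The closest point of M exists by completeness and the parallelogram law.
    Projecting in H x K rather than in one Hilbert space serves both for
    subspaces and for arguments with graphs. *)
Lemma projection H K (M : set (H * K)) : linear_relation M -> sclosed M ->
  forall x y, exists f f', M (f, f') /\
    forall g g', M (g, g') -> ip (x - f) g + ip (y - f') g' = 0.
Proof.
move=> linM clM x y.
pose d (p : H * K) := ip (x - p.1) (x - p.1) + ip (y - p.2) (y - p.2).
pose E := d @` M.
have E0 : E !=set0 by exists (d (0, 0)), (0, 0) => //; exact: lin0.
have lbE : has_inf E.
  split=> //; exists 0 => _ [p _ <-].
  by rewrite addr_ge0 ?ip_ge0.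
pose i := inf E.
have di p : M p -> i <= d p.
  by move=> Mp; apply: ge_inf; [exact: lbE.2|exists p].
have [u hu] : {u : nat -> H * K & forall n,
    M (u n) /\ d (u n) < i + n.+1%:R^-1}.
  apply: (@choice _ _ (fun n p => M p /\ d p < i + n.+1%:R^-1)) => n.
  have e0 : 0 < n.+1%:R^-1 :> R by rewrite invr_gt0 ltr0n.
  by have [_ [p Mp <-] hp] := inf_adherent e0 lbE; exists p.
have uuv m n : ip ((u m).1 - (u n).1) ((u m).1 - (u n).1) +
    ip ((u m).2 - (u n).2) ((u m).2 - (u n).2) <=
    2 / m.+1%:R + 2 / n.+1%:R.
  have [] := hu m; have [] := hu n.
  case: (u m) => f f' /=; case: (u n) => g g' /= Mg dg Mf df.
  have : i <= d ((2^-1)%:C%C *: (f + g), (2^-1)%:C%C *: (f' + g')).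
    by apply/di/(linZ linM)/(linD linM).
  move: dg df; rewrite /d /= !ipE.
  rewrite (ipC f x) (ipC g x) (ipC g f) (ipC f' y) (ipC g' y) (ipC g' f').
  move: (m.+1%:R^-1 : R) (n.+1%:R^-1 : R) => a b; lra.
have [f hf] : exists f, hcvg (fun n => (u n).1) f.
  apply: (@hcomplete2 _ _ _ (fun n => 2 / n.+1%:R)); last exact: cvg_harmonic2.
  by move=> m n _; apply: (le_trans _ (uuv m n)); rewrite lerDl ip_ge0.
have [f' hf'] : exists f', hcvg (fun n => (u n).2) f'.
  apply: (@hcomplete2 _ _ _ (fun n => 2 / n.+1%:R)); last exact: cvg_harmonic2.
  by move=> m n _; apply: (le_trans _ (uuv m n)); rewrite lerDr ip_ge0.
have Mf : M (f, f').
  apply: (clM _ _ _ _ _ hf hf') => n; rewrite -surjective_pairing.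
  by case: (hu n).
have df : d (f, f') <= i.
  have h1 : (fun n => d (u n)) @ \oo --> d (f, f').
    by apply: cvgD; apply: hcvg_ip; apply: hcvgB => //; apply: hcvg_cst.
  have h2 : (fun n => i + n.+1%:R^-1) @ \oo --> i.
    rewrite -[X in _ --> X]addr0; apply: cvgD; first exact: cvg_cst.
    exact: cvg_harmonic.
  rewrite -(cvg_lim _ h1)// -(cvg_lim _ h2)//.
  apply: ler_lim;
    [by apply/cvg_ex; exists (d (f, f'))|by apply/cvg_ex; exists i|].
  by apply: nearW => n; rewrite ltW //; case: (hu n).
exists f, f'; split=> // g g' Mg.
pose r := ip (x - f) g + ip (y - f') g'.
pose G := ip g g + ip g' g'.
have G0 : 0 <= G by rewrite addr_ge0 ?ip_ge0.
(* (f, f') minimizes the distance along the line through (g, g') *)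
have key t : 0 <= t ^+ 2 * G - 2 * t * r.
  have : d (f, f') <= d (f + t%:C%C *: g, f' + t%:C%C *: g').
    by apply: (le_trans df); apply/di/(linD linM) => //; apply: linZ.
  rewrite /d /G /r /= !ipE.
  rewrite (ipC f x) (ipC g x) (ipC g f) (ipC f' y) (ipC g' y) (ipC g' f').
  lra.
have G1 : 0 < G + 1 by lra.
(* r / G would be optimal, but G may vanish *)
have := key (r / (G + 1)).
have -> : (r / (G + 1)) ^+ 2 * G - 2 * (r / (G + 1)) * r =
    - (r ^+ 2 * ((G + 2) / (G + 1) ^+ 2)).
  by field; rewrite gt_eqF.
rewrite oppr_ge0 pmulr_lle0 ?divr_gt0 ?exprn_gt0 //; last lra.
by move=> r0; apply/eqP; rewrite -sqrf_eq0 eq_le r0 sqr_ge0.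
Qed.

Definition subsp H (M : set H) : Prop :=
  M 0 /\ forall (a : R[i]) x y, M x -> M y -> M (a *: x + y).

Definition orth H (M : set H) : set H := [set x | forall m, M m -> ip x m = 0].

Definition rel_closure H K (T : set (H * K)) : set (H * K) :=
  [set p | forall e : R, 0 < e -> exists f f', [/\ T (f, f'),
     ip (p.1 - f) (p.1 - f) < e & ip (p.2 - f') (p.2 - f') < e]].

Lemma rel_closure_sub H K (T : set (H * K)) : T `<=` rel_closure T.
Proof.
move=> [x y] Txy e e0; exists x, y.
by rewrite /= !subrr !ip0l.
Qed.

Lemma rel_closure_seq H K (T : set (H * K)) x y : rel_closure T (x, y) ->
  exists u v, [/\ forall n, T (u n, v n), hcvg u x & hcvg v y].
Proof.
move=> h.
have [u hu] : {u : nat -> H * K & forall n, [/\ T (u n),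
    ip (x - (u n).1) (x - (u n).1) < 1 / n.+1%:R &
    ip (y - (u n).2) (y - (u n).2) < 1 / n.+1%:R]}.
  apply: (@choice _ _ (fun n p => [/\ T p,
    ip (x - p.1) (x - p.1) < 1 / n.+1%:R &
    ip (y - p.2) (y - p.2) < 1 / n.+1%:R])) => n.
  have e0 : 0 < 1 / n.+1%:R :> R by rewrite divr_gt0 // ltr0n.
  by have [f [f' []]] := h _ e0; exists (f, f').
exists (fun n => (u n).1), (fun n => (u n).2); split.
- by move=> n; rewrite -surjective_pairing; case: (hu n).
- apply: (@cvg0_le _ _ (fun n => 1 / n.+1%:R)); last exact: cvg_harmonic2.
  move=> n; rewrite ip_ge0 /= -[X in X - x]opprK -opprD ipNl ipNr opprK addrC.
  by rewrite ltW //; case: (hu n).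
- apply: (@cvg0_le _ _ (fun n => 1 / n.+1%:R)); last exact: cvg_harmonic2.
  move=> n; rewrite ip_ge0 /= -[X in X - y]opprK -opprD ipNl ipNr opprK addrC.
  by rewrite ltW //; case: (hu n).
Qed.

Lemma ip_subC H (x y : H) : ip (x - y) (x - y) = ip (y - x) (y - x).
Proof. by rewrite -[y - x]opprB ipNl ipNr opprK. Qed.

Lemma hcvg_N H (u : nat -> H) x (e : R) : hcvg u x -> 0 < e ->
  exists N, forall n, (N <= n)%N -> ip (u n - x) (u n - x) < e.
Proof. by move=> hu e0; apply: (cvg0_N _ hu e0) => n; apply: ip_ge0. Qed.

Lemma rel_closureP H K (T : set (H * K)) u v x y :
  (forall n, T (u n, v n)) -> hcvg u x -> hcvg v y -> rel_closure T (x, y).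
Proof.
move=> hT hu hv e e0.
have [N hN] := hcvg_N hu e0; have [N' hN'] := hcvg_N hv e0.
exists (u (maxn N N')), (v (maxn N N')); split=> //=.
  by rewrite ip_subC; apply: hN; rewrite leq_maxl.
by rewrite ip_subC; apply: hN'; rewrite leq_maxr.
Qed.

Lemma rel_closure_sclosed H K (T : set (H * K)) : sclosed (rel_closure T).
Proof.
move=> u v x y huv hu hv e e0.
have e4 : 0 < e / 4 by rewrite divr_gt0.
have [N hN] := hcvg_N hu e4; have [N' hN'] := hcvg_N hv e4.
pose n := maxn N N'.
have [f [f' [/= Tf hf hf']]] := huv n _ e4.
exists f, f'; split=> //=.
  have := hN n (leq_maxl _ _).
  have -> : x - f = (x - u n) + (u n - f) by rewrite addrA subrK.
  by rewrite ip_subC; have := ipD_le (x - u n) (u n - f); lra.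
have := hN' n (leq_maxr _ _).
have -> : y - f' = (y - v n) + (v n - f') by rewrite addrA subrK.
by rewrite ip_subC; have := ipD_le (y - v n) (v n - f'); lra.
Qed.

Lemma rel_closure_lin H K (T : set (H * K)) : linear_relation T ->
  linear_relation (rel_closure T).
Proof.
move=> linT; apply/linP; split; first exact: (rel_closure_sub (lin0 linT)).
move=> a x x' y y' /rel_closure_seq[u [v [h1 h2 h3]]].
move=> /rel_closure_seq[u' [v' [h1' h2' h3']]].
apply: (rel_closureP (u := fun n => a *: u n + u' n)
    (v := fun n => a *: v n + v' n)).
- by move=> n; have /linP[_ h] := linT; apply: h.
- by apply: hcvgD => //; apply: hcvgZ.
- by apply: hcvgD => //; apply: hcvgZ.
Qed.

Lemma sub_biadj H K (T : set (H * K)) : T `<=` rel_biadj T.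
Proof.
move=> [x y] Txy [g g'] hg /=.
by rewrite innerC -(hg _ Txy) -innerC.
Qed.

(** The residual of the projection of an element of T** onto the closure of
    T gives an element of T*; pairing the residual with it yields
    - ||y - f'||^2 = ||x - f||^2. *)
Lemma biadj_closure H K (T : set (H * K)) : linear_relation T ->
  rel_biadj T = rel_closure T.
Proof.
move=> linT; apply/seteqP; split=> [[x y] hxy|[x y]]; last first.
  move=> /rel_closure_seq[u [v [h1 h2 h3]]].
  by apply: (biadj_sclosed _ h2 h3) => n; apply: sub_biadj.
have [f [f' [Tf hT]]] :=
  projection (rel_closure_lin linT) (@rel_closure_sclosed _ _ T) x y.
have adj : rel_adj T (- (y - f'), x - f).
  apply/(adjP linT) => g g' Tg.
  by have := hT _ _ (rel_closure_sub Tg); rewrite ipNl; lra.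
have bf : rel_biadj T (f, f').
  have [u [v [h1 h2 h3]]] := rel_closure_seq Tf.
  by apply: (biadj_sclosed _ h2 h3) => n; apply: sub_biadj.
have := (adjP (adj_lin T) _ _).1 (linB (adj_lin _) hxy bf) _ _ adj.
rewrite ipNr => h.
have h1 := ip_ge0 (x - f); have h2 := ip_ge0 (y - f').
have /ip_eq0/eqP : ip (x - f) (x - f) = 0 by lra.
have /ip_eq0/eqP : ip (y - f') (y - f') = 0 by lra.
by rewrite !subr_eq0 => /eqP -> /eqP ->.
Qed.

Lemma biadj_id H K (T : set (H * K)) : linear_relation T -> sclosed T ->
  rel_biadj T = T.
Proof.
move=> linT clT; rewrite biadj_closure //; apply/seteqP; split.
  move=> [x y] /rel_closure_seq[u [v [h1 h2 h3]]].
  exact: (clT _ _ _ _ h1 h2 h3).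
exact: rel_closure_sub.
Qed.

Lemma adj_biadj H K (T : set (H * K)) : linear_relation T ->
  rel_adj (rel_biadj T) = rel_adj T.
Proof.
by move=> linT; apply: (biadj_id (adj_lin T) (adj_sclosed linT)).
Qed.

(** A subspace of H seen as a relation, so that projections onto it are an
    instance of [projection]. *)
Definition null_rel H (M : set H) : set (H * H) :=
  [set p | M p.1 /\ p.2 = 0].

Lemma null_rel_lin H (M : set H) : subsp M -> linear_relation (null_rel M).
Proof.
move=> [M0 linM]; apply/linP; split=> // a y y' z z' [/= hy ->] [/= hz ->].
by split=> /=; [exact: linM|rewrite scaler0 addr0].
Qed.

Lemma subsp_proj H (M : set H) : subsp M ->
  (forall u x, (forall n, M (u n)) -> hcvg u x -> M x) ->
  forall x, exists2 p, M p & orth M (x - p).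
Proof.
move=> linM clM x.
have clN : sclosed (null_rel M).
  move=> u v y z huv hu hv; split=> /=.
    by apply: (clM u) => // n; case: (huv n).
  apply: (hcvg_unique hv).
  have -> : v = fun=> 0 by apply/funext => n; case: (huv n).
  exact: hcvg_cst.
have [f [f' [[/= Mf _] h]]] := projection (null_rel_lin linM) clN x 0.
exists f => // m Mm.
by have := h m 0 (conj Mm erefl); rewrite ip0r addr0.
Qed.

Lemma orth_subsp H (M : set H) : subsp M -> subsp (orth M).
Proof.
move=> linM; split=> [m _|a x y hx hy m Mm]; first by rewrite ip0l.
rewrite ipDl hy // addr0.
rewrite scale_split !ipE ip_i.
have [M0 hM] := linM.
rewrite (hx _ Mm) hx; first ring.
by rewrite -[_ *: m]addr0; apply: hM.
Qed.

Lemma orth_closed H (M : set H) u x :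
  (forall n, orth M (u n)) -> hcvg u x -> orth M x.
Proof.
move=> hu ux m Mm; apply: (cvgn_unique (hcvg_ipl (z := m) ux)).
have -> : (fun n => ip (u n) m) = (fun=> 0) by apply/funext => n; exact: hu.
exact: cvg_cst.
Qed.

Lemma dom_subsp H K (T : set (H * K)) : linear_relation T -> subsp (rel_dom T).
Proof.
move=> /linP[h0 h1]; split; first by exists 0.
by move=> a x y [x' hx] [y' hy]; exists (a *: x' + y'); apply: h1.
Qed.

Lemma mul_subsp H K (T : set (H * K)) : linear_relation T -> subsp (rel_mul T).
Proof.
move=> /linP[h0 h1]; split; first by [].
by move=> a x y hx hy; have := h1 a _ _ _ _ hx hy; rewrite scaler0 addr0.
Qed.

Lemma mul_closed H K (T : set (H * K)) : sclosed T ->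
  forall u x, (forall n, rel_mul T (u n)) -> hcvg u x -> rel_mul T x.
Proof.
move=> clT u x hu ux; apply: (clT (fun=> 0) u) => //.
exact: hcvg_cst.
Qed.

(** The form in which topological closures of domains are used. *)
Lemma closure_orth H (M : set H) : subsp M -> closure M = orth (orth M).
Proof.
move=> linM; apply/seteqP; split=> x.
- move=> clx z hz.
  have : rel_closure (null_rel M) (x, 0).
    move=> e e0; have s0 : 0 < Num.sqrt e by rewrite sqrtr_gt0.
    have sC : 0 < (Num.sqrt e)%:C%C by rewrite ltcR.
    have [m [Mm]] := clx _ (nbhsx_ballx x _ sC).
    rewrite -ball_normE /= normC_hnorm ltcR hnorm_lt // sqr_sqrtr ?ltW // => h.
    by exists m, 0; split=> //=; rewrite subrr ip0l.
  move=> /rel_closure_seq[u [v [h1 h2 _]]].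
  apply: (cvgn_unique (hcvg_ipl (z := z) h2)).
  have -> : (fun n => ip (u n) z) = (fun=> 0).
    by apply/funext => n; rewrite ipC; apply: hz; case: (h1 n).
  exact: cvg_cst.
- move=> hx.
  have [f [f' [Nf h]]] :=
    projection (rel_closure_lin (null_rel_lin linM))
      (@rel_closure_sclosed _ _ (null_rel M)) x 0.
  have ox : orth M (x - f).
    move=> m Mm.
    have := h m 0 (rel_closure_sub (conj Mm erefl : null_rel M (m, 0))).
    by rewrite ip0r addr0.
  have xf : x = f.
    have [u [v [h1 h2 _]]] := rel_closure_seq Nf.
    have h3 : ip f (x - f) = 0.
      apply: (cvgn_unique (hcvg_ipl (z := x - f) h2)).
      have -> : (fun n => ip (u n) (x - f)) = (fun=> 0).
        by apply/funext => n; rewrite ipC; apply: ox; case: (h1 n).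
      exact: cvg_cst.
    have h4 := hx _ ox.
    have : ip (x - f) (x - f) = 0 by rewrite ipDl ipNl h3 h4 subrr.
    by move/ip_eq0/eqP; rewrite subr_eq0 => /eqP.
  rewrite -xf in Nf.
  move=> B /nbhs_ballP[e e0 hB].
  have [r r0 re] : exists2 r : R, 0 < r & e = r%:C%C.
    move: e0; case: (e) => a b; rewrite /= ltcE /= => /andP[/eqP -> a0].
    by exists a.
  have [m [m' [[/= Mm _] hm _]]] := Nf _ (exprn_gt0 2 r0).
  exists m; split=> //; apply: hB.
  by rewrite -ball_normE /= normC_hnorm re ltcR hnorm_lt.
Qed.

Lemma closed_sclosed H K (T : set (H * K)) : closed T -> sclosed T.
Proof.
move=> clT u v x y huv /hcvgP hu /hcvgP hv.
have h : (fun n => (u n, v n)) @ \oo --> (x, y) by apply: cvg_pair.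
by apply: (closed_cvg _ clT _ _ h); apply: nearW.
Qed.

End LinearRelationTheory.

(** * Regular parts, the products A* A and their forms *)

Section RegularPart.
Context {R : realType}.
Implicit Types H K L : hilbertType R.

Lemma orth_inner H (M : set H) x m : subsp M -> orth M x -> M m ->
  inner x m = 0.
Proof.
move=> [M0 linM] hx hm.
rewrite -(linear0l inner (0 : H)); apply: inner_eq.
  by rewrite hx // ip0l.
by rewrite ip0l hx // -[_ *: m]addr0; apply: linM.
Qed.

Lemma orth_projP H (M : set H) x : subsp M ->
  (forall u x, (forall n, M (u n)) -> hcvg u x -> M x) ->
  M (orth_proj M x) /\ orth M (x - orth_proj M x).
Proof.
move=> linM clM.
have [p Mp hp] := subsp_proj linM clM x.
have [] : [set p | M p /\ forall m, M m -> inner (x - p) m = 0] (orth_proj M x).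
  apply: xgetPex; exists p; split=> // m Mm; exact: orth_inner linM hp Mm.
by move=> h1 h2; split=> // m Mm; rewrite /ip h2.
Qed.

(** The operator A_reg for closed A: its value at x is the element of smallest
    norm among the images of x. *)
Definition regval H K (A : set (H * K)) (x : H) (s : K) : Prop :=
  A (x, s) /\ orth (rel_mul A) s.

Section Regval.
Variables (H K : hilbertType R) (A : set (H * K)).
Hypotheses (linA : linear_relation A) (clA : sclosed A).

Lemma regval_uniq x s t : regval A x s -> regval A x t -> s = t.
Proof.
move=> [h1 h2] [h3 h4].
have h : rel_mul A (s - t).
  by rewrite /rel_mul /= -[0](subrr x); apply: (linB linA).
apply/eqP; rewrite -subr_eq0; apply/eqP/ip_eq0.
by rewrite ipDl ipNl h2 // h4 // subrr.
Qed.

Lemma regval_ex x y : A (x, y) -> exists2 s, regval A x s & ip s s <= ip y y.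
Proof.
move=> Axy.
have [p hp h] := subsp_proj (mul_subsp linA) (mul_closed clA) y.
exists (y - p).
  by split=> //; rewrite -[x]subr0; apply: (linB linA).
have := h p hp; have := ip_ge0 p.
by rewrite !ipE (ipC p y); lra.
Qed.

End Regval.

(** An element g of dom (T_reg)* matters only through its component
    orthogonal to mul T**, and dom T* is orthogonal to mul T**. So
    (T_reg)** and T** differ only by mul T**. *)
Lemma biadj_reg H K (T : set (H * K)) x s : linear_relation T ->
  rel_biadj (rel_reg T) (x, s) <-> regval (rel_biadj T) x s.
Proof.
move=> linT.
set M := rel_mul (rel_biadj T).
have linM : subsp M by apply/mul_subsp/biadj_lin.
have prj z := orth_projP z linM (mul_closed (@biadj_sclosed _ _ _ T)).
set P := orth_proj M in prj.
have mulT m g g' : M m -> rel_adj T (g, g') -> inner g m = 0.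
  by move=> Mm hg; rewrite innerC (Mm _ hg) /= linear0l conjc0.
split=> [h|[h1 h2] [g g'] hg /=].
- split.
    move=> [g g'] hg; apply: (h (g, g')) => -[f w] [z Tfz].
    rewrite /rel_graph /= => ->.
    rewrite linearBr /= (mulT (P z) _ _ _ hg) ?subr0; first exact: (hg (f, z)).
    by have [] := prj z.
  move=> m Mm.
  have := h (m, 0); rewrite /= linear0r /ip => -> // -[f w] [z Tfz].
  rewrite /rel_graph /= => ->.
  rewrite linear0l innerC; have [_ hz] := prj z.
  by rewrite (orth_inner linM hz Mm) conjc0.
- have hT : rel_adj T (g - P g, g').
    move=> [f z] Tfz /=.
    have -> : inner g' f = inner g (z - P z).
      by apply: (hg (f, z - P z)); exists z.
    have [mg og] := prj g; have [mz oz] := prj z.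
    rewrite linearBr linearBl /=; congr (_ - _).
    have h3 := orth_inner linM og mz; have h4 := orth_inner linM oz mg.
    move: h3 h4; rewrite !linearBl /= => /eqP; rewrite subr_eq0 => /eqP ->.
    move=> /eqP; rewrite subr_eq0 => /eqP h5.
    by rewrite innerC -h5 -innerC.
  have := h1 _ hT; rewrite /= linearBr /= => <-.
  have [mg _] := prj g.
  by rewrite (orth_inner linM h2 mg) subr0.
Qed.

(** The contraction of the domination extends to the closures, and the
    regular part has the smallest norm among all values. *)
Lemma contr_dominated_regval H K L (T1 : set (H * K)) (T2 : set (H * L)) x s :
  linear_relation T1 -> linear_relation T2 -> contr_dominated T1 T2 ->
  regval (rel_biadj T2) x s ->
  exists2 t, regval (rel_biadj T1) x t & ip t t <= ip s s.
Proof.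
move=> lin1 lin2 [C hC CT] [Txs _].
have hC' y : ip (C y) (C y) <= ip y y.
  by rewrite -!hnormE ler_pXn2r // nnegrE hnorm_ge0.
have h : rel_biadj T1 (x, C s).
  move: Txs; rewrite !biadj_closure // => /rel_closure_seq[u [v [h1 h2 h3]]].
  apply: (rel_closureP (u := u) (v := C \o v)) => // [n|].
    by apply: CT; exists (v n) => //; exact: h1.
  apply: (@cvg0_le _ _ (fun n => ip (v n - s) (v n - s))) => // n.
  by rewrite ip_ge0 /= -linearB.
have [t ht le] := regval_ex (biadj_lin T1) (@biadj_sclosed _ _ _ T1) h.
by exists t => //; apply: (le_trans le).
Qed.

Definition adjmul H K (A : set (H * K)) : set (H * H) :=
  (rel_adj A \; A)%relation.

Lemma adjmul_form H K (A : set (H * K)) f' s g t : linear_relation A ->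
  rel_adj A (s, f') -> A (g, t) -> ip f' g = ip s t.
Proof. by move=> linA /(adjP linA); apply. Qed.

Lemma adjmul_regval H K (A : set (H * K)) f f' s : linear_relation A ->
  A (f, s) -> rel_adj A (s, f') -> regval A f s.
Proof.
move=> linA h1 h2; split=> // m hm.
by rewrite -(adjmul_form linA h2 hm) ip0r.
Qed.

Lemma nsa_lin H (S : set (H * H)) : nonneg_selfadjoint S -> linear_relation S.
Proof. by move=> [-> _]; apply: adj_lin. Qed.

Lemma nsa_sclosed H (S : set (H * H)) : nonneg_selfadjoint S -> sclosed S.
Proof. by move=> /[dup] /nsa_lin linS [-> _]; apply: adj_sclosed. Qed.

Lemma nsa_sym H (S : set (H * H)) f f' g g' : nonneg_selfadjoint S ->
  S (f, f') -> S (g, g') -> ip f' g = ip f g'.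
Proof.
move=> /[dup] /nsa_lin linS [hS _] hf hg.
by rewrite hS in hf; exact/(adjP linS _ _).1.
Qed.

Lemma nsa_pos H (S : set (H * H)) f f' : nonneg_selfadjoint S ->
  S (f, f') -> 0 <= ip f' f.
Proof. by move=> [_ h] /h; rewrite lecE => /andP[]. Qed.

Lemma adjmul_lin H K (A : set (H * K)) : linear_relation A ->
  linear_relation (adjmul A).
Proof.
move=> linA; have linA' := adj_lin A.
have /linP[h0 h1] := linA; have /linP[h0' h1'] := linA'.
apply/linP; split; first by exists 0.
move=> a x x' y y' [/= s hs hs'] [/= t ht ht'].
by exists (a *: s + t); [apply: h1|apply: h1'].
Qed.

(** Projecting (h, 0) onto A splits h as f + f' with {f, f'} in A* A. *)
Lemma adjmul_surj H K (A : set (H * K)) : linear_relation A -> sclosed A ->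
  forall h, exists f f', adjmul A (f, f') /\ f + f' = h.
Proof.
move=> linA clA h.
have [f [s [Afs hfs]]] := projection linA clA h 0.
exists f, (h - f); split; last by rewrite addrC subrK.
exists s => //=; apply/(adjP linA) => g t Agt.
by have := hfs _ _ Agt; rewrite add0r ipNl; lra.
Qed.

(** An element {g, g'} of the adjoint has the same sum as some {f, f'} in
    A* A; then {g - f, f - g} is in the adjoint, so g - f is orthogonal to the
    range of I + A* A, which is everything. *)
Lemma adjmul_nsa H K (A : set (H * K)) : linear_relation A -> sclosed A ->
  nonneg_selfadjoint (adjmul A).
Proof.
move=> linA clA; split; last first.
  move=> f f' [s /= hs hs']; have /= -> := hs' _ hs.
  by rewrite inner_norm exprn_ge0 // normr_ge0.
have sub : adjmul A `<=` rel_adj (adjmul A).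
  move=> [g g'] [/= t ht ht'] [f f'] [/= s hs hs'].
  have /= -> := ht' _ hs.
  by rewrite innerC; have /= <- := hs' _ ht; rewrite -innerC.
apply/seteqP; split=> // -[g g'] hg.
have [f [f' [hf ff']]] := adjmul_surj linA clA (g + g').
have hd := linB (adj_lin _) hg (sub _ hf).
have e : g' - f' = - (g - f).
  rewrite opprB; apply/eqP; rewrite subr_eq addrAC eq_sym subr_eq.
  by rewrite ff' addrC.
rewrite e in hd.
have [k [k' [hk kk']]] := adjmul_surj linA clA (g - f).
have := (adjP (adjmul_lin linA) _ _).1 hd _ _ hk.
rewrite ipNl => h0.
have : ip (g - f) (g - f) = 0 by rewrite -{2}kk' ipDr; lra.
move=> /ip_eq0 gf0.
move/eqP: e; rewrite gf0 oppr0 subr_eq0 => /eqP ->.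
by move/eqP : gf0; rewrite subr_eq0 => /eqP ->.
Qed.

(** Nonnegativity makes the range of I + c S closed; a vector orthogonal to it
    gives an element {c w, - w} of S, which nonnegativity rules out
    unless w = 0. *)
Lemma nsa_surj H (S : set (H * H)) (c : R) : nonneg_selfadjoint S -> 0 < c ->
  forall h, exists f f', S (f, f') /\ f + c%:C%C *: f' = h.
Proof.
move=> nS c0 h.
have linS := nsa_lin nS; have clS := nsa_sclosed nS.
pose M : set H := [set y | exists f f', S (f, f') /\ f + c%:C%C *: f' = y].
have linM : subsp M.
  have /linP[S0 hS] := linS.
  split; first by exists 0, 0; rewrite scaler0 addr0.
  move=> a _ _ [f [f' [hf <-]]] [g [g' [hg <-]]].
  exists (a *: f + g), (a *: f' + g'); split; first exact: hS.
  by rewrite !scalerDr addrACA !scalerA mulrC.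
have clM u y : (forall n, M (u n)) -> hcvg u y -> M y.
  move=> hu uy.
  have [w hw] : {w : nat -> H * H & forall n, S (w n) /\
      (w n).1 + c%:C%C *: (w n).2 = u n}.
    apply: (@boolp.choice _ _
      (fun n w => S w /\ w.1 + c%:C%C *: w.2 = u n)) => n.
    by have [f [f' hf]] := hu n; exists (f, f').
  have bnd m n : ip ((w m).1 - (w n).1) ((w m).1 - (w n).1) <=
      ip (u m - u n) (u m - u n).
    have [h1 <-] := hw m; have [h2 <-] := hw n.
    move: h1 h2; case: (w m) => f f'; case: (w n) => g g' /= h1 h2.
    have := nsa_pos nS (linB linS h1 h2).
    have := ip_ge0 (f' - g').
    have -> : f + c%:C%C *: f' - (g + c%:C%C *: g') =
        (f - g) + c%:C%C *: (f' - g').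
      by rewrite scalerBr opprD addrACA.
    move: (f - g) (f' - g') => a b hb hab.
    rewrite !ipE (ipC b a) -subr_ge0.
    rewrite ipC in hab.
    have -> : ip a a + c * ip a b + (c * ip a b + c * (c * ip b b)) - ip a a =
      2 * (c * ip a b) + c ^+ 2 * ip b b by ring.
    by rewrite addr_ge0 // !mulr_ge0 // ltW.
  have [f hf] : exists f, hcvg (fun n => (w n).1) f.
    apply: (@hcomplete2 _ _ _ (fun n => 2 * ip (u n - y) (u n - y))).
      move=> m n _; apply: (le_trans (bnd m n)).
      have -> : u m - u n = (u m - y) - (u n - y) by rewrite opprB addrA subrK.
      have := ipD_le (u m - y) (- (u n - y)).
      by rewrite !(ipNl, ipNr) opprK.
    rewrite -[X in _ --> X](mulr0 2).
    by apply: cvgM => //; exact: cvg_cst.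
  have c1 : c^-1%:C%C * c%:C%C = 1 :> R[i].
    by rewrite -rmorphM /= mulVf ?gt_eqF.
  have hf' : hcvg (fun n => (w n).2) (c^-1%:C%C *: (y - f)).
    have -> : (fun n => (w n).2) = (fun n => c^-1%:C%C *: (u n - (w n).1)).
      apply/funext => n; have [_ <-] := hw n.
      by rewrite [X in X - _]addrC addrK scalerA c1 scale1r.
    by apply: hcvgZ; apply: hcvgB.
  exists f, (c^-1%:C%C *: (y - f)); split.
    apply: (clS _ _ _ _ _ hf hf') => n.
    by rewrite -surjective_pairing; case: (hw n).
  by rewrite scalerA mulrC c1 scale1r addrC subrK.
have [_ [f [f' [hf <-]]] horth] := subsp_proj linM clM h.
have [w wE] : exists w, w = h - (f + c%:C%C *: f') by eexists.
rewrite -wE in horth.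
have w0 : w = 0.
  have hS : S (c%:C%C *: w, - w).
    have [-> _] := nS; apply/(adjP linS) => g g' hg.
    have : ip w (g + c%:C%C *: g') = 0.
      by apply: horth; exists g, g'.
    by rewrite !ipE; lra.
  have := nsa_pos nS hS; rewrite !ipE oppr_ge0 pmulr_rle0 // => w0.
  by apply/ip_eq0/eqP; rewrite eq_le w0 ip_ge0.
exists f, f'; split=> //.
by apply/eqP; rewrite eq_sym -subr_eq0 -wE w0.
Qed.

(** A sequence in S that converges to x also for the form of S. The third
    condition makes the form values nondecreasing and the sequence Cauchy for
    the form. *)
Definition form_seq H (S : set (H * H)) (x : H) (u v : nat -> H) (l : R) :=
  [/\ forall n, S (u n, v n), hcvg u x,
      forall m n, (m <= n)%N -> ip (v m - v n) (u m - u n) <=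
        ip (v n) (u n) - ip (v m) (u m) &
      (fun n => ip (v n) (u n)) @ \oo --> l].

(** The resolvent approximations u_k = (I + S/k)^{-1} x. Since
    x = u_k + v_k / k, the hypothesis at v_k bounds both (v_k, u_k)
    and ||v_k||^2 / k. The bound on the increments amounts to
    (v_m, u_n - u_m) >= 0 for m <= n, a consequence of
    (v_m - v_n, u_m - u_n) >= 0 and the Cauchy-Schwarz inequality. *)
Lemma yosida H (S : set (H * H)) x (c : R) : nonneg_selfadjoint S ->
  0 <= c ->
  (forall f f', S (f, f') -> ip x f' ^+ 2 <= c * ip f' f) ->
  exists u v l, form_seq S x u v l /\ l <= c.
Proof.
move=> nS c0 hx.
have linS := nsa_lin nS.
have [w hw] : {w : nat -> H * H & forall n, S (w n) /\
    (w n).1 + (n.+1%:R^-1)%:C%C *: (w n).2 = x}.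
  apply: (@boolp.choice _ _ (fun n w => S w /\
    w.1 + (n.+1%:R^-1)%:C%C *: w.2 = x)) => n.
  have k0 : 0 < n.+1%:R^-1 :> R by rewrite invr_gt0 ltr0n.
  by have [f [f' hf]] := nsa_surj nS k0 x; exists (f, f').
pose u n := (w n).1; pose v n := (w n).2.
have Suv n : S (u n, v n) by rewrite -surjective_pairing; case: (hw n).
have xE n : x = u n + (n.+1%:R^-1)%:C%C *: v n by case: (hw n).
have q0 n : 0 <= ip (v n) (u n) by apply: (nsa_pos nS).
have k0 n : 0 < n.+1%:R^-1 :> R by rewrite invr_gt0 ltr0n.
have main n : (ip (v n) (u n) + n.+1%:R^-1 * ip (v n) (v n)) ^+ 2 <=
    c * ip (v n) (u n).
  by have := hx _ _ (Suv n); rewrite {1}(xE n) !ipE (ipC (u n)).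
have qv n : 0 <= n.+1%:R^-1 * ip (v n) (v n).
  by rewrite mulr_ge0 ?ip_ge0 // ltW.
have qc n : ip (v n) (u n) <= c.
  have := main n; have := q0 n; have := qv n.
  move: (ip _ _) (_ * _) => a b b0 a0 h; nra.
have vc n : n.+1%:R^-1 * ip (v n) (v n) <= c.
  have := main n; have := q0 n; have := qv n; have := qc n.
  move: (ip _ (u n)) (_ * _) => a b ac b0 a0 h; nra.
have incr m n : (m <= n)%N -> 0 <= ip (v m - v n) (u m - u n) <=
    ip (v n) (u n) - ip (v m) (u m).
  move=> mn.
  have kl : n.+1%:R^-1 <= m.+1%:R^-1 :> R.
    by rewrite lef_pV2 ?posrE ?ltr0n // ler_nat ltnS.
  have D0 := nsa_pos nS (linB linS (Suv m) (Suv n)).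
  rewrite D0 /=.
  have sym := nsa_sym nS (Suv m) (Suv n).
  have uE j : u j = x - (j.+1%:R^-1)%:C%C *: v j.
    by rewrite [in RHS](xE j) addrK.
  have kp := k0 m; have lp := k0 n.
  (* by symmetry of S the claim reduces to one mixed term *)
  suff : 0 <= ip (v m) (u n - u m).
    rewrite !ipE; move: sym; rewrite [ip (u m) _]ipC => sym; lra.
  have CS := ip_CS (v m) (v n).
  have A0 := ip_ge0 (v m).
  move: D0 {sym}; rewrite !uE; move: kl kp lp.
  move: (m.+1%:R^-1 : R) (n.+1%:R^-1 : R) => k l kl k00 l00.
  rewrite !ipE (ipC (v n) (v m)).
  move: CS A0.
  move: (ip (v m) (v m)) (ip (v n) (v n)) (ip (v m) (v n)) => A B P.
  move=> CS A0 D0.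
  rewrite leNgt; apply/negP => neg.
  have lt1 : k * A < l * P by lra.
  have lt2 : A < P.
    rewrite ltNge; apply/negP => PA.
    have : l * P <= k * A by apply: ler_pM => //; nra.
    lra.
  have D1 : 0 <= (k + l) * P - l * B - k * A by lra.
  have h1 : 0 <= A * ((k + l) * P - l * B - k * A) by rewrite mulr_ge0.
  have h2 : 0 < (P - A) * (l * P - k * A) by rewrite mulr_gt0 ?subr_gt0.
  have h3 : 0 <= l * (A * B - P ^+ 2) by rewrite mulr_ge0 ?subr_ge0 // ltW.
  nra.
have nd : nondecreasing_seq (fun n => ip (v n) (u n)).
  move=> m n mn; rewrite -subr_ge0.
  by have /andP[h1 h2] := incr _ _ mn; apply: le_trans h2.
have cv : cvgn (fun n => ip (v n) (u n)).
  by apply: nondecreasing_is_cvgn => //; exists c => _ [n _ <-]; apply: qc.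
exists u, v, (limn (fun n => ip (v n) (u n))); split; last first.
  by apply: limr_le => //; apply: nearW.
split=> //.
  apply: (@cvg0_le _ _ (fun n => c / n.+1%:R)); last exact: cvg_harmonic2.
  move=> n; rewrite ip_ge0 /= (_ : u n - x = - ((n.+1%:R^-1)%:C%C *: v n)).
    rewrite !ipE opprK mulrC.
    by rewrite ler_wpM2r // ltW.
  by rewrite [in LHS](xE n) opprD addrA subrr add0r.
by move=> m n /incr /andP[].
Qed.

Lemma cvg_absB0 (a : nat -> R) l : a @ \oo --> l ->
  (fun n => `|a n - l|) @ \oo --> (0 : R).
Proof.
move=> h; rewrite -(@normr0 _ R); apply: cvg_norm.
by rewrite -(subrr l); apply: cvgB => //; exact: cvg_cst.
Qed.

Lemma cvgn_le (a b : nat -> R) x y : a @ \oo --> x -> b @ \oo --> y ->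
  (forall n, a n <= b n) -> x <= y.
Proof.
move=> ha hb ab; rewrite -(cvg_lim _ ha)// -(cvg_lim _ hb)//.
apply: ler_lim; [by apply/cvg_ex; exists x|by apply/cvg_ex; exists y|].
by apply: nearW.
Qed.

(** Boundedness of the values transfers to the inequality that [yosida] asks
    for A* A, and the values of A at the resulting approximations of x form a
    Cauchy sequence. *)
Lemma weak_closed H K (A : set (H * K)) u s x (c : nat -> R) (l : R) :
  linear_relation A -> sclosed A ->
  (forall n, A (u n, s n)) -> hcvg u x -> c @ \oo --> l ->
  (forall n, ip (s n) (s n) <= c n) ->
  exists2 t, regval A x t & ip t t <= l.
Proof.
move=> linA clA Aus ux cl sc.
have nA := adjmul_nsa linA clA.
have l0 : 0 <= l.
  apply: (cvgn_le _ cl (a := fun=> 0)); first exact: cvg_cst.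
  by move=> n; apply: le_trans (sc n); apply: ip_ge0.
have [||p [q [l' [[Apq px incr ql] l'l]]]] := @yosida _ _ x l nA.
- by [].
- move=> f f' [r /= hr hr']; rewrite (adjmul_form linA hr' hr).
  apply: (cvgn_le (a := fun n => ip (u n) f' ^+ 2)
    (b := fun n => c n * ip r r)).
  + rewrite expr2; under eq_fun do rewrite expr2.
    by apply: cvgM; apply: hcvg_ipl.
  + by apply: cvgM => //; exact: cvg_cst.
  + move=> n; rewrite ipC (adjmul_form linA hr' (Aus n)) ipC.
    apply: (le_trans (ip_CS _ _)).
    by rewrite ler_wpM2r ?ip_ge0.
have [r hr] : {r : nat -> K & forall n, A (p n, r n) /\ rel_adj A (r n, q n)}.
  apply: (@boolp.choice _ _ (fun n r => A (p n, r) /\ rel_adj A (r, q n))) => n.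
  by have [r] := Apq n; exists r.
have rr m n : ip (r m - r n) (r m - r n) = ip (q m - q n) (p m - p n).
  have [h1 h2] := hr m; have [h3 h4] := hr n.
  apply/esym/(adjmul_form linA); last exact: (linB linA).
  exact: (linB (adj_lin A)).
have [t rt] : exists t, hcvg r t.
  apply: (@hcomplete2 _ _ _ (fun n => `|ip (q n) (p n) - l'|)).
    move=> m n mn; rewrite rr; apply: (le_trans (incr _ _ mn)).
    have := ler_norm (ip (q n) (p n) - l').
    have := ler_norm (l' - ip (q m) (p m)); rewrite distrC; lra.
  exact: cvg_absB0.
exists t.
  split; first by apply: (clA _ _ _ _ _ px rt) => n; case: (hr n).
  apply: (orth_closed (u := r)) rt => n; have [h1 h2] := hr n.
  by have [] := adjmul_regval linA h1 h2.
apply: le_trans l'l.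
rewrite (cvgn_unique (hcvg_ip rt rt) (_ : _ --> l')) //.
have -> : (fun n => ip (r n) (r n)) = (fun n => ip (q n) (p n)) => //.
apply/funext => n; have [h1 h2] := hr n.
by rewrite (adjmul_form linA h2 h1).
Qed.

End RegularPart.

(** * Monotone families of closed relations *)

Section MonotoneFamily.
Context {R : realType}.
Variables (H : hilbertType R) (K : nat -> hilbertType R).
Variables (A : forall n, set (H * K n)) (S : set (H * H)).
Arguments A n : clear implicits.
Hypotheses (linA : forall n, linear_relation (A n))
  (clA : forall n, sclosed (A n))
  (monoA : forall m n, (m <= n)%N -> forall x s, regval (A n) x s ->
     exists2 t, regval (A m) x t & ip t t <= ip s s)
  (nS : nonneg_selfadjoint S)
  (appS : forall f f', S (f, f') -> exists u v,
     [/\ forall n, adjmul (A n) (u n, v n), hcvg u f & hcvg v f']).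
Arguments clA n : clear implicits.

Lemma hcvg_shift (k : nat) (u : nat -> H) x : hcvg u x ->
  hcvg (fun n => u (n + k)%N) x.
Proof.
rewrite /hcvg => hu.
by rewrite (cvg_shiftn k (fun n => ip (u n - x) (u n - x))).
Qed.

(** For k >= n the value of A_n at u_k is dominated by that of A_k, whose
    squared norm is (v_k, u_k); then [weak_closed] applies. *)
Lemma dom_le_form f f' : S (f, f') -> forall n,
  exists2 s, regval (A n) f s & ip s s <= ip f' f.
Proof.
move=> Sf n; have [u [v [huv uf vf]]] := appS Sf.
have [s hs] : {s : nat -> K n & forall k, regval (A n) (u (k + n)%N) (s k) /\
    ip (s k) (s k) <= ip (v (k + n)%N) (u (k + n)%N)}.
  apply: (@boolp.choice _ _ (fun k s => regval (A n) (u (k + n)%N) s /\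
    ip s s <= ip (v (k + n)%N) (u (k + n)%N))) => k.
  have [t /= At At'] := huv (k + n)%N.
  have [r hr le] := monoA (leq_addl k n)
    (adjmul_regval (linA (k + n)) At At').
  by exists r; split => //; rewrite (adjmul_form (linA _) At' At).
apply: (weak_closed (u := fun k => u (k + n)%N) (s := s)
  (c := fun k => ip (v (k + n)%N) (u (k + n)%N)) (linA n) (clA n)).
- by move=> k; have [[]] := hs k.
- exact: hcvg_shift.
- by apply: hcvg_ip; apply: hcvg_shift.
- by move=> k; have [] := hs k.
Qed.

(** On A_n* A_n one has (x, v_n) = (A_{n,reg} x, A_{n,reg} u_n), so that
    the Cauchy-Schwarz inequality bounds (x, v_n) before the limit is
    taken. *)
Lemma form_bound x (s : forall n, K n) (c : R) :
  (forall n, regval (A n) x (s n)) -> (forall n, ip (s n) (s n) <= c) ->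
  forall f f', S (f, f') -> ip x f' ^+ 2 <= c * ip f' f.
Proof.
move=> hs sc f f' Sf; have [u [v [huv uf vf]]] := appS Sf.
apply: (cvgn_le (a := fun n => ip x (v n) ^+ 2)
    (b := fun n => c * ip (v n) (u n))).
- have h : (fun n => ip x (v n)) @ \oo --> ip x f'.
    by apply: hcvg_ip => //; exact: hcvg_cst.
  rewrite expr2; under eq_fun do rewrite expr2.
  exact: cvgM.
- by apply: cvgM; [exact: cvg_cst|exact: hcvg_ip].
move=> n; have [t /= At At'] := huv n; have [As _] := hs n.
rewrite ipC (adjmul_form (linA n) At' As) (adjmul_form (linA n) At' At).
by apply: (le_trans (ip_CS _ _)); rewrite mulrC ler_wpM2r ?ip_ge0.
Qed.

(** The upper bound comes from [weak_closed]. For the lower bound,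
    ||s||^2 >= 2 (s, t) - ||t||^2 with t the value of A_n at an approximation
    of u_k; the right-hand side only involves A_n* A_n, so it
    tends to 2 (x, v_k) - (v_k, u_k) >= (v_k, u_k) as n grows. *)
Lemma form_seq_val x u v l : form_seq S x u v l ->
  exists s : forall n, K n, [/\ forall n, regval (A n) x (s n),
    forall n, ip (s n) (s n) <= l &
    (fun n => ip (s n) (s n)) @ \oo --> l].
Proof.
move=> [Suv ux incr ql].
have ex n : exists s, regval (A n) x s /\ ip s s <= l.
  have [r hr] : {r : nat -> K n & forall k, regval (A n) (u k) (r k) /\
      ip (r k) (r k) <= ip (v k) (u k)}.
    apply: (@boolp.choice _ _ (fun k r => regval (A n) (u k) r /\
      ip r r <= ip (v k) (u k))) => k.
    by have [r] := dom_le_form (Suv k) n; exists r.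
  have [| |s] := weak_closed (linA n) (clA n) (u := u) (s := r) _ ux ql.
  - by move=> k; have [[]] := hr k.
  - by move=> k; have [] := hr k.
  by exists s.
pose s n := sval (cid (ex n)).
have hs n : regval (A n) x (s n) /\ ip (s n) (s n) <= l.
  exact: svalP (cid (ex n)).
exists s; split=> [n|n|]; [by case: (hs n)|by case: (hs n)|].
apply/cvgrPdist_lt => e e0.
have e2 : 0 < e / 2 by rewrite divr_gt0.
(* k is fixed so that the form value at u k is close to l *)
have [k _ /(_ k (leqnn k)) hk] := (cvgrPdist_lt _ _).1 ql _ e2.
have xv : ip (v k) (u k) <= ip x (v k).
  apply: (cvgn_le (a := fun=> ip (v k) (u k))
      (b := fun j => ip (u (j + k)%N) (v k))); first exact: cvg_cst.
    exact/hcvg_ipl/hcvg_shift.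
  move=> j; have := incr k (j + k)%N (leq_addl _ _).
  rewrite !ipE (nsa_sym nS (Suv (j + k)%N) (Suv k)).
  rewrite (ipC (v k) (u (j + k)%N)); lra.
have [p [q [hpq pu qv]]] := appS (Suv k).
have lim : (fun n => 2 * ip x (q n) - ip (q n) (p n)) @ \oo -->
    2 * ip x (v k) - ip (v k) (u k).
  apply: cvgB; last exact: hcvg_ip.
  apply: cvgM; first exact: cvg_cst.
  by apply: hcvg_ip => //; exact: hcvg_cst.
move/cvgrPdist_lt : lim => /(_ _ e2); apply: filterS => n hn.
have [[As _] sl] := hs n.
have [t /= At At'] := hpq n.
have : 2 * ip x (q n) - ip (q n) (p n) <= ip (s n) (s n).
  rewrite (ipC x) (adjmul_form (linA n) At' As) (adjmul_form (linA n) At' At).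
  by have := ip_ge0 (s n - t); rewrite !ipE (ipC (s n) t); lra.
have h1 := le_lt_trans (ler_norm _) hn.
have h2 := le_lt_trans (ler_norm _) hk.
by rewrite ger0_norm ?subr_ge0 //; lra.
Qed.

End MonotoneFamily.

Section FormDomain.
Context {R : realType}.
Variables (H L : hilbertType R) (B : set (H * L)).
Hypotheses (linB : linear_relation B) (clB : sclosed B).

Lemma cst_mono (m n : nat) : (m <= n)%N -> forall x s, regval B x s ->
  exists2 t, regval B x t & ip t t <= ip s s.
Proof. by move=> _ x s hs; exists s. Qed.

Lemma cst_app f f' : adjmul B (f, f') -> exists u v,
  [/\ forall n : nat, adjmul B (u n, v n), hcvg u f & hcvg v f'].
Proof.
by move=> h; exists (fun=> f), (fun=> f'); split=> //; exact: hcvg_cst.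
Qed.

Variables (K : nat -> hilbertType R) (A : forall n, set (H * K n)).
Arguments A n : clear implicits.
Hypotheses (linA : forall n, linear_relation (A n))
  (clA : forall n, sclosed (A n))
  (monoA : forall m n, (m <= n)%N -> forall x s, regval (A n) x s ->
     exists2 t, regval (A m) x t & ip t t <= ip s s)
  (appB : forall f f', adjmul B (f, f') -> exists u v,
     [/\ forall n, adjmul (A n) (u n, v n), hcvg u f & hcvg v f']).
Arguments clA n : clear implicits.

(** [form_seq_val] is applied twice to the same approximating sequence: to
    the family A, and to the constant family B, which identifies the limit
    as ||t||^2. *)
Lemma form_dom_sub x t : regval B x t ->
  exists s : forall n, K n, [/\ forall n, regval (A n) x (s n),
    forall n, ip (s n) (s n) <= ip t t &
    (fun n => ip (s n) (s n)) @ \oo --> ip t t].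
Proof.
move=> Bt; have nB := adjmul_nsa linB clB.
have bnd := @form_bound R H (fun=> L) (fun=> B) _ (fun=> linB) cst_app
  x (fun=> t) (ip t t) (fun=> Bt) (fun=> lexx _).
have [u [v [l [hl _]]]] := yosida nB (ip_ge0 t) bnd.
have [t' [ht' _ tl]] := @form_seq_val R H (fun=> L) (fun=> B) _ (fun=> linB)
  (fun=> clB) cst_mono nB cst_app x u v l hl.
have <- : l = ip t t.
  apply: (cvgn_unique tl).
  have -> : (fun n => ip (t' n) (t' n)) = (fun=> ip t t).
    by apply/funext => n; rewrite (regval_uniq linB (ht' n) Bt).
  exact: cvg_cst.
exact: (form_seq_val linA clA monoA nB appB hl).
Qed.

Lemma form_dom_sup x (s : forall n, K n) (c : R) :
  (forall n, regval (A n) x (s n)) -> (forall n, ip (s n) (s n) <= c) ->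
  exists t, regval B x t.
Proof.
move=> hs sc; have nB := adjmul_nsa linB clB.
have c0 : 0 <= c by apply: le_trans (sc 0); exact: ip_ge0.
have bnd := form_bound linA appB hs sc.
have [u [v [l [hl _]]]] := yosida nB c0 bnd.
have [t' [ht' _ _]] := @form_seq_val R H (fun=> L) (fun=> B) _ (fun=> linB)
  (fun=> clB) cst_mono nB cst_app x u v l hl.
by exists (t' 0%N).
Qed.

End FormDomain.

(** * Square roots of bounded operators *)

Section SquareRoot.
Context {R : realType}.
Implicit Types H K L : hilbertType R.

Lemma hnorm_triangle H (x y : H) : hnorm (x + y) <= hnorm x + hnorm y.
Proof. by rewrite -lecR rmorphD /= -!normC_hnorm ler_normD. Qed.

Lemma hnormZ H (c : R) (x : H) : 0 <= c -> hnorm (c%:C%C *: x) = c * hnorm x.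
Proof.
move=> c0; rewrite !hnorm_sqrt !ipE mulrA -expr2 sqrtrM ?sqr_ge0 //.
by rewrite sqrtr_sqr ger0_norm.
Qed.

Definition op_linear H (A : H -> H) : Prop :=
  forall (a : R[i]) x y, A (a *: x + y) = a *: A x + A y.
Definition op_sym H (A : H -> H) : Prop := forall x y, ip (A x) y = ip x (A y).
Definition op_contr H (A : H -> H) : Prop :=
  forall x, ip (A x) (A x) <= ip x x.

Lemma opD H (A : H -> H) x y : op_linear A -> A (x + y) = A x + A y.
Proof. by move=> h; have := h 1 x y; rewrite !scale1r. Qed.

Lemma op0 H (A : H -> H) : op_linear A -> A 0 = 0.
Proof.
by move=> h; have := h (-1) 0 0; rewrite scaler0 addr0 scaleN1r addNr.
Qed.

Lemma opZ H (A : H -> H) a x : op_linear A -> A (a *: x) = a *: A x.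
Proof. by move=> h; have := h a x 0; rewrite (op0 h) !addr0. Qed.

Lemma opN H (A : H -> H) x : op_linear A -> A (- x) = - A x.
Proof. by move=> h; rewrite -scaleN1r (opZ _ _ h) scaleN1r. Qed.

Lemma opB H (A : H -> H) x y : op_linear A -> A (x - y) = A x - A y.
Proof. by move=> h; rewrite (opD _ _ h) (opN _ h). Qed.

Section Iteration.
Variables (H : hilbertType R) (A : H -> H).
Hypotheses (linA : op_linear A) (symA : op_sym A) (conA : op_contr A).

(** The iteration X_{n+1} = (A + X_n^2) / 2, whose fixed points X satisfy
    (I - X)^2 = I - A. *)
Fixpoint root_iter (n : nat) (x : H) : H :=
  if n is n'.+1 then
    (2^-1)%:C%C *: (A x + root_iter n' (root_iter n' x)) else 0.

(** The same iteration for the scalar 1: it dominates the operator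
    iteration. *)
Fixpoint root_bound (n : nat) : R :=
  if n is n'.+1 then (1 + root_bound n' ^+ 2) / 2 else 0.

Lemma root_iter_lin n : op_linear (root_iter n).
Proof.
elim: n => [|n IH] a x y /=; first by rewrite scaler0 addr0.
rewrite linA !IH !scalerDr !scalerA [_ * a]mulrC -!addrA; congr (_ + _).
by rewrite !addrA; congr (_ + _); rewrite addrC.
Qed.

Lemma root_iter_sym n : op_sym (root_iter n).
Proof.
elim: n => [|n IH] x y /=; first by rewrite ip0l ip0r.
by rewrite !ipE symA !IH.
Qed.

Lemma root_bound01 n : 0 <= root_bound n <= 1.
Proof. elim: n => [|n /andP[h1 h2]] /=; apply/andP; split=> //; nra. Qed.

Lemma root_boundS n : root_bound n.+1 = (1 + root_bound n ^+ 2) / 2.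
Proof. by []. Qed.

Lemma root_bound_le n : root_bound n <= root_bound n.+1.
Proof.
elim: n => [|n IH]; first by rewrite /=; lra.
rewrite (root_boundS n.+1) {1}(root_boundS n) ler_pM2r ?invr_gt0 // lerD2l.
have /andP[h1 _] := root_bound01 n; have /andP[h3 _] := root_bound01 n.+1.
by rewrite ler_pXn2r.
Qed.

Lemma root_bound_nd : {homo root_bound : m n / (m <= n)%N >-> m <= n}.
Proof. by apply/nondecreasing_seqP; exact: root_bound_le. Qed.

Lemma root_iter_norm n x : hnorm (root_iter n x) <= root_bound n * hnorm x.
Proof.
elim: n x => [|n IH] x /=.
  by rewrite mul0r hnorm_sqrt ip0l sqrtr0.
rewrite hnormZ ?invr_ge0 // mulrC mulrAC ler_pM2r ?invr_gt0 //.
apply: (le_trans (hnorm_triangle _ _)); rewrite mulrDl mul1r; apply: lerD.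
  by rewrite -(@ler_pXn2r _ 2) ?nnegrE ?hnorm_ge0 // !hnormE.
apply: (le_trans (IH _)); rewrite expr2 -mulrA.
by rewrite ler_wpM2l //; have /andP[] := root_bound01 n.
Qed.

(** X_{n+2} - X_{n+1} is half of X_{n+1} (X_{n+1} - X_n) + (X_{n+1} - X_n) X_n,
    and the scalar iteration satisfies the same identity. *)
Lemma root_iter_step n x : hnorm (root_iter n.+1 x - root_iter n x) <=
  (root_bound n.+1 - root_bound n) * hnorm x.
Proof.
elim: n x => [|n IH] x.
  by rewrite /= !subr0; have := root_iter_norm 1 x.
have -> : root_iter n.+2 x - root_iter n.+1 x = (2^-1)%:C%C *:
    (root_iter n.+1 (root_iter n.+1 x - root_iter n x) +
     (root_iter n.+1 (root_iter n x) - root_iter n (root_iter n x))).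
  rewrite (opB _ _ (root_iter_lin n.+1)) addrA subrK.
  rewrite [in RHS]/= -/(root_iter n.+1 x).
  rewrite {1}[root_iter n.+2 x]/= {3}[root_iter n.+1 x]/= -scalerBr.
  by rewrite opprD addrACA subrr add0r.
rewrite hnormZ ?invr_ge0 //.
have -> : root_bound n.+2 - root_bound n.+1 =
    2^-1 * (root_bound n.+1 * (root_bound n.+1 - root_bound n) +
            (root_bound n.+1 - root_bound n) * root_bound n).
  by have := root_boundS n; rewrite (root_boundS n.+1); lra.
rewrite -mulrA ler_pM2l ?invr_gt0 //.
apply: (le_trans (hnorm_triangle _ _)); rewrite mulrDl; apply: lerD.
  apply: (le_trans (root_iter_norm _ _)); rewrite -mulrA ler_wpM2l //.
  by have /andP[] := root_bound01 n.+1.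
apply: (le_trans (IH _)); rewrite -mulrA ler_wpM2l //.
  by rewrite subr_ge0 root_bound_le.
exact: root_iter_norm.
Qed.

Lemma root_iter_dist m n x : (m <= n)%N ->
  hnorm (root_iter n x - root_iter m x) <=
  (root_bound n - root_bound m) * hnorm x.
Proof.
move=> mn; rewrite -(subnK mn); elim: (n - m)%N => [|k IH].
  by rewrite add0n !subrr mul0r hnorm_sqrt ip0l sqrtr0.
have -> : root_iter (k.+1 + m) x - root_iter m x =
    (root_iter (k + m).+1 x - root_iter (k + m) x) +
    (root_iter (k + m) x - root_iter m x) by rewrite addrA subrK.
apply: (le_trans (hnorm_triangle _ _)).
apply: (le_trans (lerD (root_iter_step _ _) IH)).
by rewrite -mulrDl addrA subrK.
Qed.

Lemma root_iter_cvg x : exists y, hcvg (fun n => root_iter n x) y.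
Proof.
have cv : cvgn root_bound.
  apply: nondecreasing_is_cvgn; first exact: root_bound_nd.
  by exists 1 => _ [n _ <-]; have /andP[] := root_bound01 n.
apply: (@hcomplete2 _ _ _
  (fun n => `|root_bound n - limn root_bound| * ip x x)).
  move=> m n mn; rewrite ip_subC -!hnormE.
  have h := root_iter_dist x mn.
  have d0 : 0 <= root_bound n - root_bound m.
    by rewrite subr_ge0 root_bound_nd.
  have d1 : root_bound n - root_bound m <= 1.
    by have /andP[] := root_bound01 n; have /andP[] := root_bound01 m; lra.
  apply: (@le_trans _ _ ((root_bound n - root_bound m) * hnorm x ^+ 2)).
    apply: (@le_trans _ _ (((root_bound n - root_bound m) * hnorm x) ^+ 2)).
      by rewrite ler_pXn2r // nnegrE ?hnorm_ge0 // mulr_ge0 ?hnorm_ge0.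
    rewrite exprMn ler_wpM2r ?sqr_ge0 // expr2 -{3}[_ - _]mulr1.
    by rewrite ler_wpM2l.
  rewrite -mulrDl ler_wpM2r ?sqr_ge0 //.
  have := ler_norm (root_bound n - limn root_bound).
  have := ler_norm (limn root_bound - root_bound m); rewrite distrC; lra.
rewrite -[X in _ --> X](mul0r (ip x x)).
by apply: cvgM; [exact: cvg_absB0|exact: cvg_cst].
Qed.

Lemma root_iter_comm n (G : H -> H) : op_linear G ->
  (forall x, G (A x) = A (G x)) ->
  forall x, G (root_iter n x) = root_iter n (G x).
Proof.
move=> linG GA; elim: n => [|n IH] x /=; first exact: op0.
by rewrite (opZ _ _ linG) (opD _ _ linG) GA !IH.
Qed.

Lemma hcvg_contr (G : H -> H) u x : op_linear G -> op_contr G -> hcvg u x ->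
  hcvg (fun n => G (u n)) (G x).
Proof.
move=> linG conG; apply: cvg0_le => n.
by rewrite ip_ge0 /= -(opB _ _ linG).
Qed.

Lemma root_iter_contr n : op_contr (root_iter n).
Proof.
move=> x; rewrite -!hnormE ler_pXn2r ?nnegrE ?hnorm_ge0 //.
apply: (le_trans (root_iter_norm n x)); rewrite -{2}[hnorm x]mul1r.
by rewrite ler_wpM2r ?hnorm_ge0 //; have /andP[] := root_bound01 n.
Qed.

(** For a selfadjoint contraction A the operator I - X is the nonnegative
    square root of I - A. Commutation is stated for contractions because it
    must pass to the limit of the iteration. *)
Lemma sqrt_contraction : exists X : H -> H,
  [/\ op_linear X, op_sym X, op_contr X,
      forall x, X x = (2^-1)%:C%C *: (A x + X (X x)) &
      forall G, op_linear G -> op_contr G -> (forall x, G (A x) = A (G x)) ->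
        forall x, G (X x) = X (G x)].
Proof.
have [X hX] : {X : H -> H & forall x, hcvg (fun n => root_iter n x) (X x)}.
  by apply: (@boolp.choice _ _ (fun x y => hcvg (fun n => root_iter n x) y));
     exact: root_iter_cvg.
have linX : op_linear X.
  move=> a x y; apply: (hcvg_unique (hX _)).
  have -> : (fun n => root_iter n (a *: x + y)) =
      (fun n => a *: root_iter n x + root_iter n y).
    by apply/funext => n; exact: root_iter_lin.
  by apply: hcvgD => //; apply: hcvgZ.
exists X; split=> //.
- move=> x y; apply: (cvgn_unique (hcvg_ipl (z := y) (hX x))).
  have -> : (fun n => ip (root_iter n x) y) = (fun n => ip x (root_iter n y)).
    by apply/funext => n; exact: root_iter_sym.
  by apply: hcvg_ip => //; exact: hcvg_cst.
- move=> x; apply: (cvgn_le (hcvg_ip (hX x) (hX x)) (cvg_cst _)) => n.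
  exact: root_iter_contr.
- move=> x; apply: (@hcvg_unique _ _ (fun n => root_iter n.+1 x)).
    rewrite [X in hcvg X](_ : _ = fun n => root_iter (n + 1)%N x).
      exact: (@hcvg_shift _ _ 1 (fun n => root_iter n x)).
    by apply/funext => n; rewrite addn1.
  rewrite /=; apply: hcvgZ; apply: hcvgD; first exact: hcvg_cst.
  have -> : (fun n => root_iter n (root_iter n x)) =
      (fun n => root_iter n (root_iter n x - X x) + root_iter n (X x)).
    by apply/funext => n; rewrite (opB _ _ (root_iter_lin n)) subrK.
  rewrite -[X (X x)]add0r; apply: hcvgD => //.
  apply: cvg0_le (hX x) => n; rewrite ip_ge0 /= subr0.
  exact: root_iter_contr.
- move=> G linG conG GA x; apply: (hcvg_unique (hcvg_contr linG conG (hX x))).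
  have -> : (fun n => G (root_iter n x)) = (fun n => root_iter n (G x)) => //.
  by apply/funext => n; exact: root_iter_comm.
Qed.

End Iteration.

(** B is (I + S)^{-1}; both B and I - B are contractions, so that
    both have square roots by [sqrt_contraction]. *)
Lemma nsa_resolvent H (S : set (H * H)) : nonneg_selfadjoint S ->
  exists B : H -> H, [/\ op_linear B, op_sym B, op_contr B,
    op_contr (fun x => x - B x) &
    (forall x, S (B x, x - B x)) /\
    (forall f f', S (f, f') -> B (f + f') = f)].
Proof.
move=> nS; have linS := nsa_lin nS.
have [B hB] : {B : H -> H & forall x, S (B x, x - B x)}.
  apply: (@boolp.choice _ _ (fun x f => S (f, x - f))) => x.
  have [f [f' [hf <-]]] := nsa_surj nS ltr01 x; exists f.
  by rewrite [f + _]addrC addrK scale1r.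
have uniq f f' : S (f, f') -> B (f + f') = f.
  move=> hf; have := nsa_pos nS (linB linS (hB (f + f')) hf).
  have -> : f + f' - B (f + f') - f' = - (B (f + f') - f).
    by rewrite opprB addrAC addrK.
  rewrite ipNl oppr_ge0 => h.
  apply/eqP; rewrite -subr_eq0; apply/eqP/ip_eq0/eqP.
  by rewrite eq_le h ip_ge0.
exists B; split => //.
- move=> a x y; have /linP[_ h] := linS.
  rewrite -[in LHS](subrK (B x) x) -[in LHS](subrK (B y) y).
  have := uniq _ _ (h a _ _ _ _ (hB x) (hB y)).
  by rewrite addrACA -scalerDr ![_ + (_ - _)]addrC.
- move=> x y; have := nsa_sym nS (hB x) (hB y).
  by rewrite ipDl ipDr ipNl ipNr; lra.
- move=> x; have := nsa_pos nS (hB x); have := ip_ge0 (x - B x).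
  by rewrite !ipE (ipC (B x) x); lra.
- move=> x /=; have := nsa_pos nS (hB x); have := ip_ge0 (B x).
  by rewrite !ipE (ipC (B x) x); lra.
Qed.

Lemma one_sub_linear H (X : H -> H) : op_linear X ->
  op_linear (fun x => x - X x).
Proof. by move=> h a x y; rewrite h scalerBr opprD addrACA. Qed.

Lemma one_sub_sym H (X : H -> H) : op_sym X -> op_sym (fun x => x - X x).
Proof. by move=> h x y; rewrite !ipE h. Qed.

Lemma one_sub_sqr H (A X : H -> H) : op_linear X ->
  (forall x, X x = (2^-1)%:C%C *: (A x + X (X x))) ->
  forall x, (x - X x) - X (x - X x) = x - A x.
Proof.
move=> linX hX x; rewrite (opB _ _ linX); apply: ip_ext => z.
by have := congr1 (fun y => ip y z) (hX x); rewrite !ipE; lra.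
Qed.

(** P and Q are the square roots of (I + S)^{-1} and I - (I + S)^{-1}. The
    product P Q is nonnegative because a square root of P commutes with Q. *)
Lemma nsa_roots H (S : set (H * H)) : nonneg_selfadjoint S ->
  exists P Q : H -> H, [/\ op_linear P /\ op_linear Q, op_sym P /\ op_sym Q,
    forall x, P (Q x) = Q (P x),
    forall x, 0 <= ip (Q x) (P x) &
    [/\ forall x, P (P x) + Q (Q x) = x, forall x, S (P (P x), Q (Q x)) &
        forall f f', S (f, f') -> P (P (f + f')) = f]].
Proof.
move=> nS.
have [B [linB' symB conB conB' [SB uB]]] := nsa_resolvent nS.
have [X1 [lin1 sym1 con1 eq1 com1]] := sqrt_contraction
  (one_sub_linear linB') (one_sub_sym symB) conB'.
have [X2 [lin2 sym2 con2 eq2 com2]] := sqrt_contraction linB' symB conB.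
have [X3 [lin3 sym3 con3 eq3 com3]] := sqrt_contraction lin1 sym1 con1.
pose P x := x - X1 x; pose Q x := x - X2 x; pose P' x := x - X3 x.
have PP x : P (P x) = B x.
  by rewrite /P (one_sub_sqr lin1 eq1) opprB addrC subrK.
have QQ x : Q (Q x) = x - B x by rewrite /Q (one_sub_sqr lin2 eq2).
have P'P' x : P' (P' x) = P x by rewrite /P' (one_sub_sqr lin3 eq3).
have X2B x : X2 (B x) = B (X2 x) by rewrite -com2.
have X12 x : X2 (X1 x) = X1 (X2 x).
  by apply: com1 => // y; rewrite opB // X2B.
have X23 x : X2 (X3 x) = X3 (X2 x) by apply: com3.
have pos2 (x : H) : 0 <= ip x (x - X2 x).
  have := ip_CS x (X2 x); have := con2 x; have := ip_ge0 x.
  rewrite !ipE; move: (ip x x) (ip (X2 x) _) (ip x (X2 x)) => a b c a0 ba h.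
  rewrite subr_ge0 leNgt; apply/negP => ac; nra.
exists P, Q; split; [split|split| | |split].
- exact: one_sub_linear.
- exact: one_sub_linear.
- exact: one_sub_sym.
- exact: one_sub_sym.
- move=> x; rewrite /P /Q (opB _ _ lin1) (opB _ _ lin2) X12.
  by apply: ip_ext => z; rewrite !ipE; lra.
- move=> x.
  have P'Q : P' (Q x) = Q (P' x).
    rewrite /P' /Q (opB _ _ lin3) (opB _ _ lin2) X23.
    by apply: ip_ext => z; rewrite !ipE; lra.
  have -> : ip (Q x) (P x) = ip (P' x) (Q (P' x)).
    by rewrite -P'P' -(one_sub_sym sym3) -/(P' (Q x)) P'Q ipC.
  exact: pos2.
- by move=> x; rewrite PP QQ addrC subrK.
- by move=> x; rewrite PP QQ.
- by move=> f f' /uB; rewrite PP.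
Qed.

End SquareRoot.

(** * Square roots of relations and partial isometries *)

Section Roots.
Context {R : realType}.
Implicit Types H K L : hilbertType R.

Lemma mul_nsa H (S : set (H * H)) : nonneg_selfadjoint S ->
  rel_mul S = orth (rel_dom S).
Proof.
move=> nS; have linS := nsa_lin nS.
apply/seteqP; split=> m.
  by move=> hm f [f' hf]; rewrite (nsa_sym nS hm hf) ip0l.
move=> hm; have [hS _] := nS; rewrite /rel_mul /= hS.
by apply/(adjP linS) => f f' hf; rewrite ip0l hm //; exists f'.
Qed.

Lemma reg_closed H K (A : set (H * K)) x s : linear_relation A -> sclosed A ->
  rel_reg A (x, s) <-> regval A x s.
Proof.
move=> linA clA; rewrite /rel_reg (biadj_id linA clA) /rel_graph.
have prj z := orth_projP z (mul_subsp linA) (mul_closed clA).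
split=> [[z /= Az ->]|[As os]].
  have [h1 h2] := prj z; split=> //.
  by rewrite -[x]subr0; apply: linB.
exists s => //=; have [h1 h2] := prj s.
suff -> : orth_proj (rel_mul A) s = 0 by rewrite subr0.
apply: ip_eq0; move: (h2 _ h1); rewrite ipDl ipNl (os _ h1) add0r.
by move/eqP; rewrite oppr_eq0 => /eqP.
Qed.

Lemma sym_nonneg H (S : set (H * H)) : S `<=` rel_adj S ->
  (forall f f', S (f, f') -> 0 <= ip f' f) -> rel_nonneg S.
Proof.
move=> sS pS f f' hf; rewrite lecE; apply/andP; split; last exact: pS.
have /= := sS _ hf _ hf; rewrite [RHS]innerC.
case: (inner f' f) => a b /= [] h.
by apply/eqP; lra.
Qed.

(** The square root is {{P y, Q y} : y in X}. Selfadjointness: if {g, g'} is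
    in the adjoint then P g' = Q g, and P^2 + Q^2 = I shows that
    {g, g'} = {P y, Q y} for y = P g + Q g'. The choice X = H yields S
    itself, and X = (mul S)^perp its operator part; P and Q preserve
    X because mul S is the kernel of P^2. *)
Lemma sqrt_in_ex H (S : set (H * H)) (X : set H) : nonneg_selfadjoint S ->
  X = setT \/ X = orth (rel_mul S) ->
  exists Q, nonneg_selfadjoint_in X Q /\
    (Q \; Q)%relation = [set p | S p /\ X (p.1 + p.2)].
Proof.
move=> nS hX; have linS := nsa_lin nS.
have [P [Q [[linP' linQ] [symP symQ] PQ pos [PPQQ SPQ uP]]]] := nsa_roots nS.
have mulP m : rel_mul S m <-> P (P m) = 0.
  split=> [/uP|h]; first by rewrite add0r.
  rewrite /rel_mul /= -[in X in S (_, X)](PPQQ m) h add0r -[in X in S (X, _)]h.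
  exact: SPQ.
have linX : subsp X.
  case: hX => ->; first by split.
  exact/orth_subsp/mul_subsp.
have XP y : X y -> X (P y).
  case: hX => ->; first by [].
  move=> hy m /mulP hm; rewrite symP; apply: hy; apply/mulP.
  by rewrite hm (op0 linP').
have XQ y : X y -> X (Q y).
  case: hX => ->; first by [].
  move=> hy m /mulP hm; rewrite symQ; apply: hy; apply/mulP.
  by rewrite !PQ hm (op0 linQ).
have XD y z : X y -> X z -> X (y + z).
  by move=> hy hz; have [_ h] := linX; rewrite -[y]scale1r; apply: h.
have XN y : X y -> X (- y).
  move=> hy; have [h0 h] := linX.
  by rewrite -scaleN1r -[_ *: y]addr0; apply: h.
pose N : set (H * H) := [set p | exists2 y, X y & p = (P y, Q y)].
have linN : linear_relation N.
  have [X0 hX'] := linX.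
  apply/linP; split; first by exists 0; rewrite ?(op0 linP') ?(op0 linQ).
  move=> a _ _ _ _ [y Xy [-> ->]] [z Xz [-> ->]].
  by exists (a *: y + z); [exact: hX'|rewrite linP' linQ].
have sN : N `<=` rel_adj N.
  move=> _ [y Xy ->]; apply/(adjP linN) => _ _ [z Xz [-> ->]].
  by rewrite symQ symP -PQ.
have pre g g' : P g' = Q g -> g = P (P g + Q g') /\ g' = Q (P g + Q g').
  move=> e; rewrite (opD _ _ linP') (opD _ _ linQ); split.
    by rewrite PQ e PPQQ.
  by rewrite -PQ -e PPQQ.
exists N; split; first split.
- apply/seteqP; split=> [p Np|[g g'] [adj [Xg Xg']]].
    split; first exact: sN.
    by case: Np => y Xy -> /=; split=> /=; [exact: XP|exact: XQ].
  have e : P g' = Q g.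
    apply/eqP; rewrite -subr_eq0; apply/eqP/ip_eq0.
    set w := (X in ip X X).
    have Xw : X w by apply: XD; [exact: XP|exact/XN/XQ].
    rewrite {1}/w ipDl ipNl symP symQ.
    have -> : ip g' (P w) = ip g (Q w).
      by apply: ((adjP linN _ _).1 adj); exists w.
    exact: subrr.
  have [e1 e2] := pre _ _ e.
  exists (P g + Q g'); first by apply: XD; [exact: XP|exact: XQ].
  by rewrite -e1 -e2.
- by apply: (sym_nonneg sN) => _ _ [y _ [-> ->]].
apply/seteqP; split=> [[f f'] [z /= [y Xy [-> ->]] [w Xw [e ->]]]|[f f'] /=].
  have [e1 e2] := pre _ _ (esym e).
  split=> /=; last by apply: XD; [exact: XP|exact: XQ].
  by have := SPQ (P y + Q w); rewrite -e1 -e2.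
move=> [hf Xff].
have ef := uP _ _ hf.
have ef' : Q (Q (f + f')) = f'.
  by apply: (addrI f); rewrite -{1}ef PPQQ.
exists (Q (P (f + f'))) => /=.
  by exists (P (f + f')); [exact: XP|rewrite ef].
by exists (Q (f + f')); [exact: XQ|rewrite ef' PQ].
Qed.

(** For a selfadjoint square root Q one has Q* Q = Q Q = S. *)
Lemma rel_sqrtP H (S : set (H * H)) : nonneg_selfadjoint S ->
  nonneg_selfadjoint (rel_sqrt S) /\ adjmul (rel_sqrt S) = S.
Proof.
move=> nS.
have [] : [set Q | nonneg_selfadjoint Q /\ (Q \; Q)%relation = S] (rel_sqrt S).
  apply: xgetPex; have [Q [[hQ pQ] QQ]] := sqrt_in_ex nS (or_introl erefl).
  exists Q; split.
    split=> //; rewrite {1}hQ; apply/seteqP; split=> [p []//|p hp].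
    by split.
  by rewrite QQ; apply/seteqP; split=> [p []//|p hp].
by move=> h1 h2; split=> //; rewrite /adjmul -(proj1 h1).
Qed.

(** The square root is selfadjoint in the closure of dom S only; its adjoint
    in H has in addition the multivalued part mul S, which is exactly what
    the operator part of S lacks. *)
Lemma sqrt_op_partP H (S : set (H * H)) : nonneg_selfadjoint S ->
  [/\ linear_relation (sqrt_op_part S), sclosed (sqrt_op_part S),
      rel_mul (sqrt_op_part S) = [set 0] & adjmul (sqrt_op_part S) = S].
Proof.
move=> nS; have linS := nsa_lin nS; have clS := nsa_sclosed nS.
have mS := mul_nsa nS.
have clo : closure (rel_dom S) = orth (rel_mul S).
  by rewrite closure_orth ?mS //; exact: dom_subsp.
set Q := sqrt_op_part S.
have [[hQ _] QQ] : nonneg_selfadjoint_in (closure (rel_dom S)) Q /\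
    (Q \; Q)%relation = op_part S.
  pose prop := [set N : set (H * H) |
    nonneg_selfadjoint_in (closure (rel_dom S)) N /\
    (N \; N)%relation = op_part S].
  suff : prop Q by [].
  apply: xgetPex; rewrite /prop clo.
  have [N [hN NN]] := sqrt_in_ex nS (or_intror erefl).
  exists N; split=> //; rewrite NN.
  apply/seteqP; split=> [[f f'] /= [hf hX]|[f f']].
    apply/(reg_closed _ _ linS clS); split=> // m hm.
    have h0 : ip f m = 0 by rewrite ipC (nsa_sym nS hm hf) ip0l.
    by move: (hX m hm); rewrite ipDl h0 add0r.
  move=> /(reg_closed _ _ linS clS)[hf of']; split=> //= m hm.
  by rewrite ipDl of' // addr0 ipC (nsa_sym nS hm hf) ip0l.
rewrite clo in hQ.
set X := orth (rel_mul S) in hQ *.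
have linX : subsp X by apply/orth_subsp/mul_subsp.
have domQ f s : Q (f, s) -> X f /\ X s.
  by rewrite hQ => -[_ []].
have adjQ p : Q p -> rel_adj Q p by rewrite {1}hQ => -[].
have linQ : linear_relation Q.
  have /linP[h0 h1] := adj_lin Q; have [X0 hX] := linX.
  rewrite hQ; apply/linP; split; first by split.
  move=> a x x' y y' [a1 [/= b1 c1]] [a2 [/= b2 c2]].
  by split; [exact: h1|split; exact: hX].
have clQ : sclosed Q.
  move=> u v x y huv ux vy; rewrite hQ; split.
    by apply: (adj_sclosed linQ _ ux vy) => n; apply: adjQ.
  split=> /=.
    by apply: (orth_closed _ ux) => n; have [] := domQ _ _ (huv n).
  by apply: (orth_closed _ vy) => n; have [] := domQ _ _ (huv n).
have regS f f' : op_part S (f, f') <-> regval S f f' by apply: reg_closed.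
have domS f f' : S (f, f') -> exists2 w, op_part S (f, w) & rel_mul S (f' - w).
  move=> hf; have [w hw _] := regval_ex linS clS hf.
  exists w; first exact/regS.
  by rewrite /rel_mul /= -[0](subrr f); apply: linB => //; case: hw.
split=> //.
- apply/seteqP; split=> [s hs|_ ->]; last exact: (lin0 linQ).
  have [_ Xs] := domQ _ _ hs.
  apply: ip_eq0; apply: Xs; rewrite mS => f [f' hf].
  have [w] := domS _ _ hf.
  rewrite -QQ => -[t /= Qt _].
  by have := (adjP linQ _ _).1 (adjQ _ hs) _ _ Qt; rewrite ip0l.
- have mulS m : rel_mul S m -> rel_adj Q (0, m).
    move=> hm; apply/(adjP linQ) => f s /domQ[Xf _].
    by rewrite ip0l ipC; apply: Xf.
  apply/seteqP; split=> [[f f'] [s /= hs hs']|[f f'] hf].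
    have [m hm hf'] := subsp_proj (mul_subsp linS) (mul_closed clS) f'.
    have h : Q (s, f' - m).
      rewrite hQ; split; last by split=> //=; have [] := domQ _ _ hs.
      by rewrite -[s]subr0; apply: (linB (adj_lin _)) => //; exact: mulS.
    have [h1 _] : regval S f (f' - m).
      by apply/regS; rewrite -QQ; exists s.
    by rewrite -[f]addr0 -[f'](subrK m); apply: (linD linS).
  have [w] := domS _ _ hf.
  rewrite -QQ => -[s /= hs hs'] hm.
  exists s => //=.
  rewrite -[s]add0r -[f'](subrK w).
  apply: (linD (adj_lin _)); first exact: mulS.
  exact: adjQ.
Qed.

Lemma polarization H K L (A : set (H * K)) (B : set (H * L)) x s t y s' t' :
  linear_relation A -> linear_relation B ->
  (forall x s t, A (x, s) -> B (x, t) -> ip s s = ip t t) ->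
  A (x, s) -> B (x, t) -> A (y, s') -> B (y, t') -> ip s s' = ip t t'.
Proof.
move=> linA linB iso hs ht hs' ht'.
have := iso _ _ _ (linD linA hs hs') (linD linB ht ht').
rewrite !ipE (iso _ _ _ hs ht) (iso _ _ _ hs' ht') (ipC s' s) (ipC t' t); lra.
Qed.

(** By polarization, A* A depends only on dom A and on the norms of the
    values of A. *)
Lemma adjmul_iso H K L (A : set (H * K)) (B : set (H * L)) :
  linear_relation A -> linear_relation B -> rel_dom A = rel_dom B ->
  (forall x s t, A (x, s) -> B (x, t) -> ip s s = ip t t) ->
  adjmul A `<=` adjmul B.
Proof.
move=> linA linB AB iso [f f'] [s /= hs hs'].
have [t ht] : rel_dom B f by rewrite -AB; exists s.
exists t => //=; apply/(adjP linB) => g t' ht'.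
have [s'' hs''] : rel_dom A g by rewrite AB; exists t'.
rewrite (adjmul_form linA hs' hs'').
exact: (polarization linA linB iso hs ht hs'' ht').
Qed.

Lemma linear_pack L K (f : L -> K) :
  (forall (a : R[i]) x y, f (a *: x + y) = a *: f x + f y) ->
  exists g : {linear L -> K}, forall x, g x = f x.
Proof.
move=> hf.
pose m := GRing.isLinear.Build R[i] L K *:%R f hf.
pose g : {linear L -> K} := HB.pack f m.
by exists g.
Qed.

(** The closure W of {{t, s} : B x = t, A x = s} is an isometric relation, and
    U sends y to the partner in W of the projection p of y onto dom W. *)
Lemma partial_isometry_ex H K L (A : set (H * K)) (B : set (H * L)) :
  linear_relation A -> linear_relation B -> rel_dom A = rel_dom B ->
  (forall x s t, A (x, s) -> B (x, t) -> ip s s = ip t t) ->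
  exists U : {linear L -> K}, partial_isometry U /\
    A = (rel_graph U \; B)%relation.
Proof.
move=> linA linB' AB iso.
pose W0 : set (L * K) := [set p | exists2 x, B (x, p.1) & A (x, p.2)].
have linW0 : linear_relation W0.
  have /linP[A0 hA] := linA; have /linP[B0 hB] := linB'.
  apply/linP; split; first by exists 0.
  move=> a t s t' s' [x /= b1 a1] [y /= b2 a2].
  by exists (a *: x + y); [exact: hB|exact: hA].
pose W := rel_closure W0.
have linW : linear_relation W := rel_closure_lin linW0.
have isoW p w : W (p, w) -> ip p p = ip w w.
  move=> /rel_closure_seq[u [v [h1 hu hv]]].
  apply: (cvgn_unique (hcvg_ip hu hu)).
  have -> : (fun n => ip (u n) (u n)) = (fun n => ip (v n) (v n)).
    by apply/funext => n; have [x /= b a] := h1 n; rewrite (iso _ _ _ a b).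
  exact: hcvg_ip.
have isoW2 p w q z : W (p, w) -> W (q, z) -> ip p q = ip w z.
  move=> h1 h2; have := isoW _ _ (linD linW h1 h2).
  rewrite !ipE (isoW _ _ h1) (isoW _ _ h2) (ipC q p) (ipC z w); lra.
pose C y p w := W (p, w) /\ orth (rel_dom W) (y - p).
have exC y : exists w, exists p, C y p w.
  have [f [f' [Wf hf]]] := projection linW (@rel_closure_sclosed _ _ _ W0) y 0.
  (* W is isometric, so (y, 0) is projected in L x K onto {p/2, U y/2} *)
  exists (2%:C%C *: f'), (2%:C%C *: f); split; first exact: (linZ linW _ Wf).
  move=> g [g' Wg]; have := hf _ _ Wg.
  by rewrite !ipE -(isoW2 _ _ _ _ Wf Wg); lra.
have uC y p w p' w' : C y p w -> C y p' w' -> w = w'.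
  move=> [h1 h2] [h3 h4]; have h := linB linW h1 h3.
  have hd : rel_dom W (p - p') by exists (w - w').
  have e : ip (p - p') (p - p') = 0.
    have -> : ip (p - p') (p - p') =
        ip (y - p') (p - p') - ip (y - p) (p - p') by rewrite !ipE; ring.
    by rewrite h2 // h4 // subrr.
  by apply/eqP; rewrite -subr_eq0; apply/eqP/ip_eq0; rewrite -(isoW _ _ h).
have [F hF] := boolp.choice exC.
have linF (a : R[i]) x y : F (a *: x + y) = a *: F x + F y.
  have [p [hp1 hp2]] := hF x; have [q [hq1 hq2]] := hF y.
  have [r hr] := hF (a *: x + y).
  apply: (uC _ _ _ _ _ hr (_ : C _ (a *: p + q) _)); split.
    have /linP[_ h] := linW; exact: h.
  have [_ h] := orth_subsp (dom_subsp linW).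
  have -> : a *: x + y - (a *: p + q) = a *: (x - p) + (y - q).
    by rewrite scalerBr opprD addrACA.
  exact: h.
have [U hU] := linear_pack linF.
have UC y p w : C y p w -> U y = w.
  by move=> h; have [q hq] := hF y; rewrite hU; exact: uC hq h.
have normU y : ip (U y) (U y) <= ip y y.
  have [p hp] := hF y; rewrite (UC _ _ _ hp); have [h1 h2] := hp.
  rewrite -(isoW _ _ h1).
  have := h2 p (ex_intro _ (F y) h1); have := ip_ge0 (y - p).
  by rewrite !ipE (ipC p y); lra.
exists U; split; first split.
- move=> x; apply/cvgrPdist_lt => e e0; apply/nbhs_ballP; exists e => //= y.
  rewrite -ball_normE /= => h; rewrite -linearB; apply: le_lt_trans h.
  rewrite !normC_hnorm lecR -(@ler_pXn2r _ 2) ?nnegrE ?hnorm_ge0 // !hnormE.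
  exact: normU.
- move=> y hy; have [p hp] := hF y; have [h1 h2] := hp.
  have Uk : U (y - p) = 0.
    by apply: (UC _ 0); split; [exact: (lin0 linW)|rewrite subr0].
  have h3 : ip y (y - p) = 0 by rewrite /ip hy.
  have h4 := h2 p (ex_intro _ (F y) h1).
  have : ip (y - p) (y - p) = 0 by rewrite ipDl ipNl h3 ipC h4 subrr.
  move=> /ip_eq0/eqP; rewrite subr_eq0 => /eqP yp.
  by rewrite !hnorm_sqrt (UC _ _ _ hp) -(isoW _ _ h1) -yp.
have UW x s t : A (x, s) -> B (x, t) -> U t = s.
  move=> hs ht; apply: (UC _ t); split.
    by apply: rel_closure_sub; exists x.
  by move=> m _; rewrite subrr ip0l.
apply/seteqP; split=> [[x s] hs|[x s] [t /= ht]].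
  have [t ht] : rel_dom B x by rewrite -AB; exists s.
  by exists t => //=; rewrite /rel_graph /= (UW _ _ _ hs ht).
rewrite /rel_graph /= => ->.
have [s' hs'] : rel_dom A x by rewrite AB; exists t.
by rewrite (UW _ _ _ hs' ht).
Qed.

(** If B is an operator then mul B* B = mul B* = (dom B)^perp, so removing the
    multivalued part of B* B amounts to requiring f' in the closure of
    dom B. *)
Lemma op_part_adjmul H L (B : set (H * L)) : linear_relation B ->
  rel_mul B = [set 0] -> nonneg_selfadjoint (adjmul B) ->
  op_part (adjmul B) =
    (rel_adj_in (closure (rel_dom B)) setT B \; B)%relation.
Proof.
move=> linB opB' nS; have linS := nsa_lin nS; have clS := nsa_sclosed nS.
have clo : closure (rel_dom B) = orth (rel_mul (adjmul B)).
  rewrite closure_orth; last exact: dom_subsp.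
  congr orth; apply/seteqP; split=> m.
    move=> hm; exists 0; first exact: (lin0 linB).
    by apply/(adjP linB) => f f' hf /=; rewrite ip0l hm //; exists f'.
  move=> [s /= hs hs'] f [f' hf]; rewrite (adjmul_form linB hs' hf).
  have -> : s = 0 by have : rel_mul B s by []; rewrite opB'.
  by rewrite ip0l.
rewrite clo; apply/seteqP; split=> -[f f'].
  by move=> /(reg_closed _ _ linS clS)[[s /= hs hs'] h]; exists s.
move=> [s /= hs [hs' [_ h]]]; apply/(reg_closed _ _ linS clS); split=> //.
by exists s.
Qed.

End Roots.

(** * The limit of a nondecreasing sequence *)

Section LimitRelation.
Context {R : realType}.
Implicit Types H K L : hilbertType R.

Lemma rel_app_eq H K (T : set (H * K)) x y :
  (forall z, T (x, z) -> z = y) -> T (x, y) -> rel_app T x = y.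
Proof.
move=> h hy; apply: h.
exact: (xgetPex 0 (ex_intro [set z | T (x, z)] y hy)).
Qed.

Lemma reg_normE H K (T : set (H * K)) x s : linear_relation T ->
  regval (rel_biadj T) x s -> reg_norm T x = hnorm s.
Proof.
move=> linT hs; rewrite /reg_norm (_ : rel_app _ x = s) //.
apply: rel_app_eq; last exact: ((biadj_reg x s linT).2 hs).
move=> z hz; have hz' := (biadj_reg x z linT).1 hz.
exact: (regval_uniq (biadj_lin T) hz' hs).
Qed.

(** The resolvent at -1 is the one used: I + S is onto, and nonnegativity makes
    its inverse single-valued. *)
Lemma resolvent_app H (S : set (H * H)) f f' : nonneg_selfadjoint S ->
  S (f, f') -> rel_app (rel_resolvent S (- 1)) (f + f') = f.
Proof.
move=> nS hf; apply: rel_app_eq; last first.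
  by exists (f, f') => //=; rewrite scaleN1r opprK addrC.
move=> z [[g g'] hg /= []]; rewrite scaleN1r opprK => e ->.
apply/eqP; rewrite -subr_eq0; apply/eqP/ip_eq0/eqP.
rewrite eq_le ip_ge0 andbT.
have := nsa_pos nS (linB (nsa_lin nS) hg hf).
have -> : g' - f' = - (g - f).
  by apply: ip_ext => y; have := congr1 (fun w => ip w y) e; rewrite !ipE; lra.
by rewrite ipNl oppr_ge0.
Qed.

Lemma cvg_hnorm (u : nat -> R) (l : R) : (forall n, 0 <= u n) -> 0 <= l ->
  (fun n => u n ^+ 2) @ \oo --> l ^+ 2 -> u @ \oo --> l.
Proof.
move=> u0 l0 h; apply/subr_cvg0; apply: cvg_sqr0.
apply: cvg0_le (cvg_absB0 h) => n; rewrite sqr_ge0 /=.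
rewrite subr_sqr normrM (ger0_norm (addr_ge0 (u0 n) l0)).
rewrite -real_normK ?num_real // expr2 ler_wpM2l //.
have := u0 n; rewrite ler_norml; move: l0 => h1 h2.
by apply/andP; split; lra.
Qed.

(** This is half of strong graph convergence. It follows from strong resolvent
    convergence at the single point -1: with h = f + f', take
    u_n = (T_n* T_n** + I)^{-1} h and v_n = h - u_n. *)
Lemma limit_approx H (TT : nat -> set (H * H)) (S : set (H * H)) :
  (forall n, nonneg_selfadjoint (TT n)) -> nonneg_selfadjoint S ->
  strong_resolvent_cvg TT S \/ strong_graph_cvg TT S ->
  forall f f', S (f, f') -> exists u v,
    [/\ forall n, TT n (u n, v n), hcvg u f & hcvg v f'].
Proof.
move=> nT nS [res|gr] f f' hf; last first.
  move: hf; rewrite gr => -[w hw wf].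
  exists (fun n => (w n).1), (fun n => (w n).2); split.
  - by move=> n; rewrite -surjective_pairing.
  - by apply/hcvgP; apply: (cvg_comp _ _ wf); exact: cvg_fst.
  - by apply/hcvgP; apply: (cvg_comp _ _ wf); exact: cvg_snd.
have neg1 : ~ (0 <= - 1 :> R[i]) by rewrite oppr_ge0 ler10.
have := res _ neg1 (f + f'); rewrite (resolvent_app nS hf).
have [w hw] : {w : nat -> H * H & forall n, TT n (w n) /\
    (w n).1 + (w n).2 = f + f'}.
  apply: (@boolp.choice _ _ (fun n w => TT n w /\ w.1 + w.2 = f + f')) => n.
  have [g [g' [hg e]]] := nsa_surj (nT n) ltr01 (f + f').
  by exists (g, g'); split => //=; rewrite -e scale1r.
have wE n : rel_app (rel_resolvent (TT n) (- 1)) (f + f') = (w n).1.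
  have [hn <-] := hw n; apply: resolvent_app => //.
  by rewrite -surjective_pairing.
have -> : (fun n => rel_app (rel_resolvent (TT n) (- 1)) (f + f')) =
    (fun n => (w n).1) by apply/funext.
move=> /hcvgP hu.
exists (fun n => (w n).1), (fun n => (w n).2); split=> // [n|].
  by rewrite -surjective_pairing; case: (hw n).
have -> : (fun n => (w n).2) = (fun n => (f + f') - (w n).1).
  by apply/funext => n; have [_ <-] := hw n; rewrite addrAC subrr add0r.
rewrite -[in X in hcvg _ X](addrK f f') addrC [f' + f]addrC.
by apply: hcvgB => //; exact: hcvg_cst.
Qed.

Section Family.
Variables (H : hilbertType R) (K : nat -> hilbertType R).
Variable T : forall n, set (H * K n).
Arguments T n : clear implicits.
Hypotheses (linT : forall n, linear_relation (T n))
  (domT : forall m n : nat, (m <= n)%N -> contr_dominated (T m) (T n)).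
Variables (L : hilbertType R) (B : set (H * L)).
Hypotheses (linB : linear_relation B) (clB : sclosed B).
Hypothesis appB : forall f f', adjmul B (f, f') -> exists u v,
  [/\ forall n, adjmul (rel_biadj (T n)) (u n, v n), hcvg u f & hcvg v f'].

Lemma family_mono m n : (m <= n)%N -> forall x s,
  regval (rel_biadj (T n)) x s ->
  exists2 t, regval (rel_biadj (T m)) x t & ip t t <= ip s s.
Proof. by move=> mn x s; apply: contr_dominated_regval => //; exact: domT. Qed.

(** Both sides are the form domain of B* B, described by the values of B and
    by those of the T_n**. *)
Lemma dom_limit : rel_dom B = limit_dom T.
Proof.
apply/seteqP; split=> x.
- move=> [y By]; have [t Bt _] := regval_ex linB clB By.
  have [s [hs st _]] := form_dom_sub linB clB (fun n => biadj_lin (T n))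
    (fun n => @biadj_sclosed _ _ _ (T n)) family_mono appB Bt.
  split; first by move=> n _; exists (s n); case: (hs n).
  apply: (@le_lt_trans _ _ (hnorm t)%:E); last exact: ltry.
  apply: ge_ereal_sup => _ [n _ <-]; rewrite lee_fin.
  rewrite (reg_normE (linT n) (hs n)).
  by rewrite -(@ler_pXn2r _ 2) ?nnegrE ?hnorm_ge0 // !hnormE.
- move=> [hx supx].
  have ex n : exists s, regval (rel_biadj (T n)) x s.
    have [y hy] := hx n I.
    have [s hs _] := regval_ex (biadj_lin (T n))
      (@biadj_sclosed _ _ _ (T n)) hy.
    by exists s.
  pose s n := sval (cid (ex n)).
  have hs n : regval (rel_biadj (T n)) x (s n) by exact: svalP (cid (ex n)).
  move: supx => /=; set M := ereal_sup _ => M_lt.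
  have leM n : ((hnorm (s n))%:E <= M)%E.
    rewrite -(reg_normE (linT n) (hs n)).
    by apply: ereal_sup_ubound; exists n.
  have [c hc] : exists c : R, forall n, hnorm (s n) <= c.
    case: M M_lt leM => [r _ h|//|_ h].
      by exists r => n; have := h n; rewrite lee_fin.
    by have := h 0%N.
  have hc2 n : ip (s n) (s n) <= c ^+ 2.
    rewrite -hnormE ler_pXn2r ?nnegrE ?hnorm_ge0 //.
    exact: le_trans (hnorm_ge0 _) (hc 0%N).
  have [t [Bt _]] :=
    form_dom_sup linB clB (fun n => biadj_lin (T n)) appB hs hc2.
  by exists t.
Qed.

Lemma norm_limit x t : regval B x t ->
  nondecreasing_cvg (fun n => reg_norm (T n) x) (hnorm t).
Proof.
move=> Bt; have [s [hs st lim]] := form_dom_sub linB clB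
  (fun n => biadj_lin (T n)) (fun n => @biadj_sclosed _ _ _ (T n))
  family_mono appB Bt.
have -> : (fun n => reg_norm (T n) x) = (fun n => hnorm (s n)).
  by apply/funext => n; exact: reg_normE.
split.
  move=> m n mn; have [r hr le] := family_mono mn (hs n).
  rewrite (regval_uniq (biadj_lin (T m)) (hs m) hr).
  by rewrite -(@ler_pXn2r _ 2) ?nnegrE ?hnorm_ge0 // !hnormE.
apply: cvg_hnorm => [n||]; try exact: hnorm_ge0.
by rewrite hnormE; under eq_fun do rewrite hnormE.
Qed.

End Family.
End LimitRelation.

Theorem theorem7p1 (R : realType) (H : hilbertType R)
    (K : nat -> hilbertType R) (T : forall n, set (H * K n))
    (linT : forall n, linear_relation (T n))
    (domT : forall m n : nat, (m <= n)%N -> contr_dominated (T m) (T n))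
    (Hinf : set (H * H)) (Hinf_nsa : nonneg_selfadjoint Hinf)
    (Hinf_lim :
       let TT n := (rel_adj (T n) \; rel_biadj (T n))%relation in
       strong_resolvent_cvg TT Hinf \/ strong_graph_cvg TT Hinf) :
  rel_dom (rel_sqrt Hinf) =
    (\bigcap_n rel_dom (rel_biadj (T n))) `&`
    [set x | (ereal_sup (range (fun n =>
       (hnorm (rel_app (rel_biadj (rel_reg (T n))) x))%:E)) < +oo)%E]
  /\
  (forall x, rel_dom (rel_sqrt Hinf) x ->
     nondecreasing_cvg
       (fun n => hnorm (rel_app (rel_biadj (rel_reg (T n))) x))
       (hnorm (rel_app (sqrt_op_part Hinf) x)))
  /\
  forall (Kc : hilbertType R) (Sr : set (H * Kc)),
    is_limit_operator T Sr ->
    [/\ rel_dom Sr = rel_dom (rel_sqrt Hinf),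
        (forall x, rel_dom Sr x ->
           nondecreasing_cvg
             (fun n => hnorm (rel_app (rel_biadj (rel_reg (T n))) x))
             (hnorm (rel_app Sr x))) &
        exists U : {linear Kc -> H},
          [/\ partial_isometry U,
              sqrt_op_part Hinf = (rel_graph U \; Sr)%relation,
              op_part Hinf =
                (rel_adj_in (closure (rel_dom Sr)) setT Sr \; Sr)%relation &
              Hinf = (rel_adj Sr \; Sr)%relation]].
Proof.
pose A n := rel_biadj (T n).
have nTT n : nonneg_selfadjoint (rel_adj (T n) \; rel_biadj (T n))%relation.
  rewrite -(adj_biadj (linT n)).
  by apply: adjmul_nsa; [exact: biadj_lin|exact: biadj_sclosed].
have app f f' : Hinf (f, f') -> exists u v,
    [/\ forall n, adjmul (A n) (u n, v n), hcvg u f & hcvg v f'].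
  move=> hf; have [u [v [h1 h2 h3]]] := limit_approx nTT Hinf_nsa Hinf_lim hf.
  by exists u, v; split=> // n; rewrite /adjmul adj_biadj.
have appB (L : hilbertType R) (B : set (H * L)) (hB : adjmul B = Hinf) f f' :
    adjmul B (f, f') -> exists u v,
    [/\ forall n, adjmul (A n) (u n, v n), hcvg u f & hcvg v f'].
  by rewrite hB; exact: app.
have [nS SS] := rel_sqrtP Hinf_nsa.
have domS : rel_dom (rel_sqrt Hinf) = limit_dom T.
  exact: (dom_limit linT domT (nsa_lin nS) (nsa_sclosed nS) (appB _ _ SS)).
have [linQ clQ opQ QQ] := sqrt_op_partP Hinf_nsa.
have domQ : rel_dom (sqrt_op_part Hinf) = limit_dom T.
  exact: (dom_limit linT domT linQ clQ (appB _ _ QQ)).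
have opval (L : hilbertType R) (B : set (H * L)) x t : linear_relation B ->
    rel_mul B = [set 0] -> B (x, t) -> regval B x t.
  by move=> linB opB Bt; split=> // m; rewrite opB => ->; rewrite ip0r.
have opapp (L : hilbertType R) (B : set (H * L)) x t : linear_relation B ->
    rel_mul B = [set 0] -> B (x, t) -> rel_app B x = t.
  move=> linB opB Bt; apply: rel_app_eq => // z Bz.
  exact: (regval_uniq linB (opval _ _ _ _ linB opB Bz)
    (opval _ _ _ _ linB opB Bt)).
split; first exact: domS.
split.
  rewrite domS -domQ => x [t Qt]; rewrite (opapp _ _ _ _ linQ opQ Qt).
  exact: (norm_limit linT domT linQ clQ (appB _ _ QQ)
    (opval _ _ _ _ linQ opQ Qt)).
move=> Kc Sr [linSr /closed_sclosed clSr opSr domSr limSr].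
have domSQ : rel_dom (sqrt_op_part Hinf) = rel_dom Sr by rewrite domQ domSr.
have iso x s t : sqrt_op_part Hinf (x, s) -> Sr (x, t) -> ip s s = ip t t.
  move=> hs ht.
  have [_ h1] := norm_limit linT domT linQ clQ (appB _ _ QQ)
    (opval _ _ _ _ linQ opQ hs).
  have [|_ h2] := limSr x; first by exists t.
  rewrite (opapp _ _ _ _ linSr opSr ht) in h2.
  by rewrite -!hnormE (cvgn_unique h1 h2).
have iso' x t s : Sr (x, t) -> sqrt_op_part Hinf (x, s) -> ip t t = ip s s.
  by move=> ht hs; rewrite (iso x s t).
have SrH : adjmul Sr = Hinf.
  rewrite -QQ; apply/seteqP; split; apply: adjmul_iso => //.
have [U [pU UE]] := partial_isometry_ex linQ linSr domSQ iso.
split=> //; first by rewrite domS.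
exists U; split=> //.
rewrite -{1}SrH; apply: op_part_adjmul => //.
by rewrite SrH.
Qed.
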